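(* There is an absolute constant $c>0$ such that for every $n\ge 3$ and every $3$-uniform hypergraph $H$ on $n$ vertices with at least one hyperedge, $Q(f_H) \ge c\, n^{4/5}$.
   Context: For a fixed $3$-uniform hypergraph $H$ on vertex set $[n]$, $f_H:\{0,1\}^{\binom{n}{3}}\to\{0,1\}$ takes as input a $3$-uniform hypergraph $G$ on $[n]$, given by the $\binom n3$ hyperedge-indicator bits (one per $3$-element subset of $[n]$), and $f_H(G)=1$ iff $H$ is isomorphic to a (not necessarily induced) subhypergraph of $G$, i.e. there is a bijection $\pi:[n]\to[n]$ mapping every hyperedge of $H$ to a hyperedge of $G$. $Q(f)$ denotes the bounded-error (success probability at least $2/3$) quantum query complexity of a Boolean function $f$. *)

(* Defs.v *)
From Stdlib Require Import Reals Lra Lia Arith List.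
Import ListNotations.
Open Scope R_scope.

Record Cx := mkCx { re : R; im : R }.
Definition C0 : Cx := mkCx 0 0.
Definition C1 : Cx := mkCx 1 0.
Definition Cadd (x y : Cx) : Cx := mkCx (re x + re y) (im x + im y).
Definition Cmul (x y : Cx) : Cx :=
  mkCx (re x * re y - im x * im y) (re x * im y + im x * re y).
Definition Cconj (x : Cx) : Cx := mkCx (re x) (- im x).
Definition Cscale (r : R) (x : Cx) : Cx := mkCx (r * re x) (r * im x).
Definition Cnorm2 (x : Cx) : R := re x * re x + im x * im x.

Definition Csum (d : nat) (f : nat -> Cx) : Cx := fold_right Cadd C0 (map f (seq 0 d)).
Definition Rsum (d : nat) (f : nat -> R) : R := fold_right Rplus 0 (map f (seq 0 d)).

(** * Linear algebra on C^d: vectors nat -> Cx, matrices nat -> nat -> Cx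
    (only entries with indices < d are meaningful). *)
Definition apply (d : nat) (M : nat -> nat -> Cx) (v : nat -> Cx) : nat -> Cx :=
  fun k => Csum d (fun j => Cmul (M k j) (v j)).

(** M is a unitary d x d matrix: M^* M = I (equivalent to unitarity in finite dim). *)
Definition unitary (d : nat) (M : nat -> nat -> Cx) : Prop :=
  forall i j, (i < d)%nat -> (j < d)%nat ->
    Csum d (fun k => Cmul (Cconj (M k i)) (M k j)) = if Nat.eqb i j then C1 else C0.

Definition e0 : nat -> Cx := fun k => if Nat.eqb k 0 then C1 else C0.

(** * 3-uniform hypergraphs on [n] = {0,...,n-1}.
    A hypergraph is given by its indicator G a b c, meaningful for a < b < c < n
    (one bit per 3-element subset {a,b,c}). *)
Definition hgraph := nat -> nat -> nat -> bool.

(** membership of the unordered triple {x,y,z} (x,y,z distinct) *)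
Definition min3 (x y z : nat) : nat := Nat.min x (Nat.min y z).
Definition max3 (x y z : nat) : nat := Nat.max x (Nat.max y z).
Definition mid3 (x y z : nat) : nat := (x + y + z - min3 x y z - max3 x y z)%nat.
Definition hasE (G : hgraph) (x y z : nat) : bool := G (min3 x y z) (mid3 x y z) (max3 x y z).

Definition contains (n : nat) (H G : hgraph) : Prop :=
  exists pi : nat -> nat,
    (forall i, (i < n)%nat -> (pi i < n)%nat) /\
    (forall i j, (i < n)%nat -> (j < n)%nat -> pi i = pi j -> i = j) /\
    (forall a b c, (a < b)%nat -> (b < c)%nat -> (c < n)%nat -> H a b c = true ->
        hasE G (pi a) (pi b) (pi c) = true).

(** * Quantum query algorithms (phase oracle model).
    Hilbert space C^(n^3 * m): basis index k <-> (query register q = k / m,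
    workspace w = k mod m), q < n^3 encodes (a,b,c) = (q/(n*n), (q/n) mod n, q mod n).
    The oracle O_G multiplies |q,w> by (-1)^{G a b c} if a < b < c, and by 1 otherwise
    (other values of q act as null queries). *)
Definition qdim (n m : nat) : nat := (n * n * n * m)%nat.

Definition phase (n m : nat) (G : hgraph) (k : nat) : R :=
  let q := (k / m)%nat in
  let a := (q / (n * n))%nat in
  let b := ((q / n) mod n)%nat in
  let c := (q mod n)%nat in
  if (Nat.ltb a b && Nat.ltb b c)%bool then (if G a b c then -1 else 1) else 1.

Definition oracle (n m : nat) (G : hgraph) (v : nat -> Cx) : nat -> Cx :=
  fun k => Cscale (phase n m G k) (v k).

Fixpoint qstate (n m : nat) (U : nat -> nat -> nat -> Cx) (G : hgraph) (t : nat)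
  : nat -> Cx :=
  match t with
  | O => apply (qdim n m) (U O) e0
  | S t' => apply (qdim n m) (U t) (oracle n m G (qstate n m U G t'))
  end.

Definition prob1 (n m : nat) (U : nat -> nat -> nat -> Cx) (out : nat -> bool)
  (G : hgraph) (T : nat) : R :=
  Rsum (qdim n m) (fun k => if out k then Cnorm2 (qstate n m U G T k) else 0).

Definition computes_fH (n : nat) (H : hgraph) (m T : nat)
  (U : nat -> nat -> nat -> Cx) (out : nat -> bool) : Prop :=
  (0 < m)%nat /\
  (forall t, (t <= T)%nat -> unitary (qdim n m) (U t)) /\
  (forall G : hgraph,
     (contains n H G -> prob1 n m U out G T >= 2/3) /\
     (~ contains n H G -> prob1 n m U out G T <= 1/3)).

(* Main.v *)
(** Ambainis' adversary method turns a family of pairs (rejected input, accepted input) in which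
    every input has many neighbours, but few that differ from it at any given position, into a
    lower bound on the number [T] of queries.  It is applied to five families, with [tau] the
    smallest size of a vertex set meeting all hyperedges of [H].

    Deleting one hyperedge from [H] gives [|E(H)| = O(T^2)].  The triples meeting a set [A] contain
    a copy of [H] exactly when [|A| >= tau]; adding one vertex to [A] gives
    [tau (n - tau + 1) = O(T^2)].  Every set of [2 (n - tau) + 3] vertices spans more than
    [n - tau] hyperedges, so averaging gives [|E(H)| (n - tau + 1)^2 = Omega(n^3)]; for [tau] linear
    in [n] the three estimates combine to [n^5 = O(T^6)].

    For small [tau], the triples meeting a fixed set of [tau - 1] vertices are rejected, and one
    full star more makes them accepted.  Between the two lies a rejected hypergraph that a union of
    stars makes accepted, where the stars have few centres in a large set [X] and their links are
    graphs on a large set [Y] disjoint from [X].  Take such a union minimizing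
    [sum_x (n + 1)^(size of the link of x)], with [k] centres and largest link of size [s].  Moving
    one centre inside [X] gives [k n = O(T^2)].  Replacing one largest link by many links of size
    [s - 1] leads, by minimality, to rejected inputs, which gives [s n = O(T^2)].  A random
    relabelling of the whole union gives [n^3 / (k s) = O(T^2)].  The product of the last three
    estimates is [n^5 = O(T^6)]. *)
From Stdlib Require Import Reals Lra Lia.
From mathcomp Require all_boot all_order all_fingroup all_algebra zify ring lra complex Rstruct.
Require Import Defs.

(* A module, because MathComp's notations would change the meaning of [(3 <= n)%nat] below. *)
Module HypergraphQueries.
Import all_boot all_order all_fingroup all_algebra zify ring lra complex Rstruct.
Set Implicit Arguments.
Unset Strict Implicit.
Unset Printing Implicit Defensive.
Local Open Scope nat_scope.

(* Ambainis' bound with [q] in place of a multiple of the squared number of queries: [r] relates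
   rejected to accepted inputs, [m0] and [m1] are its minimal degrees, and [l0] and [l1] bound
   how many neighbours of an input differ from it at a given position. *)
Definition adversary_bounded (I P : Type) (B : eqType) (query : I -> P -> B)
    (accepts : I -> Prop) (q : nat) : Prop :=
  forall (L0 L1 : finType) (r : L0 -> L1 -> bool) (x : L0 -> I) (y : L1 -> I) (m0 m1 l0 l1 : nat),
    (exists i j, r i j) ->
    (forall i j, r i j -> ~ accepts (x i) /\ accepts (y j)) ->
    (forall i j, r i j -> m0 <= #|[set j' | r i j']|) ->
    (forall i j, r i j -> m1 <= #|[set i' | r i' j]|) ->
    (forall p i j, r i j -> #|[set j' | r i j' & query (x i) p != query (y j') p]| <= l0) ->
    (forall p i j, r i j -> #|[set i' | r i' j & query (x i') p != query (y j) p]| <= l1) ->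
  m0 * m1 <= l0 * l1 * q.

Lemma adversary_bounded_transfer (I I' P P' : Type) (B B' : eqType) (query : I -> P -> B)
    (query' : I' -> P' -> B') (accepts : I -> Prop) (accepts' : I' -> Prop) (code : I' -> I) q :
    (forall x, accepts (code x) <-> accepts' x) ->
    (forall p, exists p', forall x y,
       query (code x) p != query (code y) p -> query' x p' != query' y p') ->
  adversary_bounded query accepts q -> adversary_bounded query' accepts' q.
Proof.
move=> acceptsE locate bound L0 L1 r x y m0 m1 l0 l1 rP sep deg0 deg1 load0 load1.
apply: (bound L0 L1 r (code \o x) (code \o y)) => //= [i j rij|p i j rij|p i j rij].
- by rewrite !acceptsE; apply: sep.
- have [p' p'P] := locate p; apply: leq_trans (load0 p' i j rij).
  by apply/subset_leq_card/subsetP => j'; rewrite !inE => /andP[-> /p'P].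
have [p' p'P] := locate p; apply: leq_trans (load1 p' i j rij).
by apply/subset_leq_card/subsetP => i'; rewrite !inE => /andP[-> /p'P].
Qed.

(** * Quantum query algorithms *)

Section QuantumAlgorithms.
Import Order.TTheory GRing.Theory Num.Theory.
Local Open Scope ring_scope.
Local Open Scope sesquilinear_scope.

Lemma fold_right_seqE (T : Type) (op : T -> T -> T) (idx : T) (d : nat) (f : nat -> T) :
  List.fold_right op idx (List.map f (List.seq 0 d)) = \big[op/idx]_(k < d) f k.
Proof.
rewrite -(big_mkord xpredT) /index_iota subn0.
by elim: d 0%N => [|d IH] s /=; rewrite ?big_nil // big_cons IH.
Qed.

Definition complex_of_Cx (z : Cx) : R[i] := Complex (re z) (im z).

Lemma complex_of_Csum d f : complex_of_Cx (Csum d f) = \sum_(k < d) complex_of_Cx (f k).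
Proof. by rewrite /Csum fold_right_seqE; apply: big_morph. Qed.

Definition state_col (d : nat) (v : nat -> Cx) : 'cV[R[i]]_d := \col_k complex_of_Cx (v k).

Definition cdot (z w : Cx) : R := (re z * re w + im z * im w)%R.

Definition rdot (d : nat) (v w : nat -> Cx) : R := \sum_(k < d) cdot (v k) (w k).

Lemma rdotE d v w : rdot d v w = complex.Re (((state_col d v)^t* *m state_col d w) 0 0).
Proof.
rewrite mxE raddf_sum; apply: eq_bigr => k _.
by rewrite !mxE /= mulNr opprK.
Qed.

Lemma unitary_rdot d M v w : unitary d M -> rdot d (apply d M v) (apply d M w) = rdot d v w.
Proof.
move=> M_unitary; pose A := \matrix_(i < d, j < d) complex_of_Cx (M i j).
have state_col_apply u : state_col d (apply d M u) = A *m state_col d u.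
  by apply/colP => k; rewrite !mxE complex_of_Csum; apply: eq_bigr => j _; rewrite !mxE.
have A_unitary : A^t* *m A = 1%:M.
  apply/matrixP => i j; rewrite !mxE.
  transitivity (complex_of_Cx (Csum d (fun k => Cmul (Cconj (M k i)) (M k j)))).
    by rewrite complex_of_Csum; apply: eq_bigr => k _; rewrite !mxE.
  rewrite M_unitary; try exact/ssrnat.ltP.
  by rewrite -val_eqE /=; case: PeanoNat.Nat.eqb_spec => [->|/eqP/negbTE->]; rewrite ?eqxx.
by rewrite !rdotE !state_col_apply trmx_mul map_mxM -mulmxA (mulmxA _ A) A_unitary mul1mx.
Qed.

Lemma cdot_AGM (c : R) z w : 0 < c -> 2 * cdot z w <= c * Cnorm2 z + c^-1 * Cnorm2 w.
Proof.
move=> c_gt0; rewrite /cdot /Cnorm2 !RealsE -subr_ge0.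
rewrite [X in 0 <= X](_ : _ = c^-1 * ((c * re z - re w) ^+ 2 + (c * im z - im w) ^+ 2)); last first.
  by field; apply: lt0r_neq0.
by rewrite mulr_ge0 ?addr_ge0 ?sqr_ge0 // invr_ge0 ltW.
Qed.

Lemma cdot_self z : cdot z z = Cnorm2 z.
Proof. by []. Qed.

Lemma Cnorm2_ge0 z : 0 <= Cnorm2 z.
Proof. by rewrite -cdot_self /cdot -!expr2 addr_ge0 ?sqr_ge0. Qed.

Lemma cdot_scale a b z w : cdot (Cscale a z) (Cscale b w) = a * b * cdot z w.
Proof. by rewrite /cdot /= !RealsE; ring. Qed.

(* AM-GM with weight 3/2 on the outcomes satisfying [out] and weight 2/3 on the others. *)
Lemma rdot_le_of_separated d out v w :
    rdot d v v = 1 -> rdot d w w = 1 ->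
    \sum_(k < d | out k) Cnorm2 (v k) <= 1 / 3 -> 2 / 3 <= \sum_(k < d | out k) Cnorm2 (w k) ->
  rdot d v w <= 17 / 18.
Proof.
rewrite /rdot => v_unit w_unit v_out w_out.
suff : 2 * \sum_(k < d) cdot (v k) (w k) <=
    5 / 6 * \sum_(k < d | out k) Cnorm2 (v k) - 5 / 6 * \sum_(k < d | out k) Cnorm2 (w k)
    + 2 / 3 * \sum_(k < d) cdot (v k) (v k) + 3 / 2 * \sum_(k < d) cdot (w k) (w k).
  rewrite v_unit w_unit; lra.
rewrite !big_distrr -sumrN !(big_mkcond (fun k : 'I_d => out k)) -!big_split /=.
apply: ler_sum => k _; rewrite !cdot_self.
have c_gt0 : 0 < 3 / 2 :> R by lra.
have c'_gt0 : 0 < 2 / 3 :> R by lra.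
have := cdot_AGM (v k) (w k) c_gt0; have := cdot_AGM (v k) (w k) c'_gt0.
rewrite !invf_div; case: ifP => _; lra.
Qed.

Section PhaseOracle.
Variables (d : nat) (U : nat -> nat -> nat -> Cx) (T : nat).
Hypotheses (d_gt0 : (0 < d)%N) (U_unitary : forall t, (t <= T)%N -> unitary d (U t)).

Fixpoint phase_run (phase : nat -> R) (t : nat) : nat -> Cx :=
  if t is t'.+1 then apply d (U t) (fun k => Cscale (phase k) (phase_run phase t' k))
  else apply d (U 0) e0.

Lemma rdot_phase_run0 f g : rdot d (phase_run f 0) (phase_run g 0) = 1.
Proof.
rewrite unitary_rdot; last exact: U_unitary.
rewrite /rdot (bigD1 (Ordinal d_gt0)) //= big1 => [|k k_neq0].
  by rewrite /cdot /= !RealsE; ring.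
by case: k k_neq0 => -[|k] // kd _; rewrite /cdot /= !RealsE; ring.
Qed.

Lemma rdot_phase_runS f g t : (t < T)%N ->
  rdot d (phase_run f t.+1) (phase_run g t.+1) =
  \sum_(k < d) f k * g k * cdot (phase_run f t k) (phase_run g t k).
Proof.
move=> tT; rewrite unitary_rdot; last exact: U_unitary.
by apply: eq_bigr => k _; rewrite cdot_scale.
Qed.

Lemma rdot_phase_run_self f t : (forall k, f k ^+ 2 = 1) -> (t <= T)%N ->
  rdot d (phase_run f t) (phase_run f t) = 1.
Proof.
move=> f_sqr; elim: t => [|t IH] tT; first exact: rdot_phase_run0.
by rewrite rdot_phase_runS // -IH ?(ltnW tT) //; apply: eq_bigr => k _; rewrite -expr2 f_sqr mul1r.
Qed.

Lemma rdot_phase_run_drop f g t (c : R) :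
    (forall k, f k ^+ 2 = 1) -> (forall k, g k ^+ 2 = 1) -> (t < T)%N -> 0 < c ->
  rdot d (phase_run f t) (phase_run g t) <= rdot d (phase_run f t.+1) (phase_run g t.+1) +
    (c * \sum_(k < d | f k != g k) Cnorm2 (phase_run f t k) +
     c^-1 * \sum_(k < d | f k != g k) Cnorm2 (phase_run g t k)).
Proof.
move=> f_sqr g_sqr tT c_gt0; rewrite rdot_phase_runS // /rdot !big_distrr.
rewrite !(big_mkcond (fun k : 'I_d => f k != g k)) -!big_split /=; apply: ler_sum => k _.
have [<-|fg] := eqVneq (f k) (g k); first by rewrite -expr2 f_sqr mul1r !addr0.
have fgN : f k * g k = -1.
  have := eqf_sqr (g k) (f k); rewrite f_sqr g_sqr eqxx eq_sym (negbTE fg) /= => /esym/eqP ->.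
  by rewrite mulrN -expr2 f_sqr.
by have := cdot_AGM (phase_run f t k) (phase_run g t k) c_gt0; rewrite fgN /=; lra.
Qed.

End PhaseOracle.

Lemma weighted_load (F : numFieldType) (L0 L1 K : finType) (r : L0 -> L1 -> bool)
    (bad : L0 -> L1 -> K -> bool) (w : L0 -> K -> F) (m l : nat) :
    (0 < m)%N -> (forall i k, 0 <= w i k) -> (forall i, \sum_k w i k = 1) ->
    (forall i j, r i j -> (m <= #|[set j' | r i j']|)%N) ->
    (forall k i j, r i j -> (#|[set j' | r i j' & bad i j' k]| <= l)%N) ->
  \sum_i \sum_(j | r i j) \sum_(k | bad i j k) w i k
    <= (\sum_i \sum_(j | r i j) 1) * (l%:R / m%:R).
Proof.
move=> m_gt0 w_ge0 w_sum m_le load; rewrite mulrA ler_pdivlMr ?ltr0n //.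
rewrite !big_distrl; apply: ler_sum => i _ /=.
case: (pickP (r i)) => [j rij|no_j]; last by rewrite !big_pred0 // !mul0r.
have sum_const (A : pred L1) (c : F) : \sum_(j | A j) c = c * #|[set j | A j]|%:R.
  by rewrite cardsE mulr_natr -sumr_const.
rewrite (exchange_big_dep xpredT) //=.
apply: (@le_trans _ _ (\sum_k w i k * l%:R * m%:R)).
  rewrite -big_distrl ler_wpM2r ?ler0n //; apply: ler_sum => k _ /=.
  by rewrite sum_const ler_wpM2l // ler_nat; apply: load rij.
rewrite -!big_distrl /= w_sum sum_const !mul1r mulrC ler_wpM2r ?ler0n // ler_nat.
exact: m_le rij.
Qed.

Lemma AGM_optimum (F : realFieldType) (a b c : F) : 0 <= a -> 0 <= b -> 0 <= c ->
  (forall x, 0 < x -> c <= x * a + x^-1 * b) -> c ^+ 2 <= 4 * (a * b).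
Proof.
move=> a_ge0 b_ge0 c_ge0 c_le; move: c_ge0; rewrite le_eqVlt => /predU1P[<-|c_gt0].
  by rewrite expr0n !mulr_ge0.
have c_neq0 := lt0r_neq0 c_gt0.
move: a_ge0; rewrite le_eqVlt => /predU1P[a0|a_gt0].
  have x_gt0 : 0 < 2 * (b + 1) / c by rewrite divr_gt0 //; lra.
  have := c_le _ x_gt0; rewrite -a0 mulr0 add0r invf_div mulrAC ler_pdivlMr; last by lra.
  by rewrite ler_pM2l //; lra.
have x_gt0 : 0 < c / (2 * a) by rewrite divr_gt0 //; lra.
have := ler_wpM2l (ltW c_gt0) (c_le _ x_gt0).
have -> : c * (c / (2 * a) * a + (c / (2 * a))^-1 * b) = c ^+ 2 / 2 + 2 * (a * b).
  by field; rewrite c_neq0 lt0r_neq0.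
by rewrite -expr2; lra.
Qed.

Section Ambainis.
Variables (d : nat) (U : nat -> nat -> nat -> Cx) (T : nat) (out : nat -> bool).
Variables (I : Type) (phase : I -> nat -> R) (accepts : I -> Prop).
Hypotheses (d_gt0 : (0 < d)%N) (U_unitary : forall t, (t <= T)%N -> unitary d (U t)).
Hypothesis phase_sqr : forall x k, phase x k ^+ 2 = 1.
Local Notation final x := (phase_run d U (phase x) T).
Hypothesis accepted : forall x, accepts x -> 2 / 3 <= \sum_(k < d | out k) Cnorm2 (final x k).
Hypothesis rejected : forall x, ~ accepts x -> \sum_(k < d | out k) Cnorm2 (final x k) <= 1 / 3.

Section Relation.
Variables (L0 L1 : finType) (r : L0 -> L1 -> bool) (x : L0 -> I) (y : L1 -> I).
Variables (m0 m1 l0 l1 : nat).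
Hypothesis r_separates : forall i j, r i j -> ~ accepts (x i) /\ accepts (y j).
Hypothesis deg0 : forall i j, r i j -> (m0 <= #|[set j' | r i j']|)%N.
Hypothesis deg1 : forall i j, r i j -> (m1 <= #|[set i' | r i' j]|)%N.
Hypothesis load0 : forall (k : 'I_d) i j, r i j ->
  (#|[set j' | r i j' & phase (x i) k != phase (y j') k]| <= l0)%N.
Hypothesis load1 : forall (k : 'I_d) i j, r i j ->
  (#|[set i' | r i' j & phase (x i') k != phase (y j) k]| <= l1)%N.
Hypotheses (m0_gt0 : (0 < m0)%N) (m1_gt0 : (0 < m1)%N).

Local Notation state x t := (phase_run d U (phase x) t).

Definition progress t : R := \sum_i \sum_(j | r i j) rdot d (state (x i) t) (state (y j) t).

Definition pair_count : R := \sum_i \sum_(j | r i j) 1.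

Lemma progress0 : progress 0 = pair_count.
Proof. by apply: eq_bigr => i _; apply: eq_bigr => j _; apply: (@rdot_phase_run0 _ _ T). Qed.

Lemma progress_final : progress T <= 17 / 18 * pair_count.
Proof.
rewrite /pair_count big_distrr; apply: ler_sum => i _.
rewrite big_distrr; apply: ler_sum => j rij /=.
have [x_rej y_acc] := r_separates rij.
by rewrite mulr1 (@rdot_le_of_separated _ out) ?(@rdot_phase_run_self _ _ T) ?rejected ?accepted.
Qed.

Lemma sum_Cnorm2_state z t : (t <= T)%N -> \sum_(k < d) Cnorm2 (state z t k) = 1.
Proof. by move=> tT; rewrite -(rdot_phase_run_self d_gt0 U_unitary (phase_sqr z) tT). Qed.

Lemma rejected_load t : (t <= T)%N ->
  \sum_i \sum_(j | r i j) \sum_(k < d | phase (x i) k != phase (y j) k) Cnorm2 (state (x i) t k)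
    <= pair_count * (l0%:R / m0%:R).
Proof.
move=> tT; apply: (weighted_load (bad := fun i j (k : 'I_d) => phase (x i) k != phase (y j) k)
  (w := fun i (k : 'I_d) => Cnorm2 (state (x i) t k))) => // *.
  exact: Cnorm2_ge0.
exact: sum_Cnorm2_state.
Qed.

Lemma accepted_load t : (t <= T)%N ->
  \sum_i \sum_(j | r i j) \sum_(k < d | phase (x i) k != phase (y j) k) Cnorm2 (state (y j) t k)
    <= pair_count * (l1%:R / m1%:R).
Proof.
move=> tT; rewrite /pair_count (exchange_big_dep xpredT) //=.
rewrite [X in _ <= X * _](exchange_big_dep xpredT) //=.
apply: (weighted_load (r := fun j i => r i j)
  (bad := fun j i (k : 'I_d) => phase (x i) k != phase (y j) k)
  (w := fun j (k : 'I_d) => Cnorm2 (state (y j) t k))) => //.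
- by move=> *; apply: Cnorm2_ge0.
- by move=> *; apply: sum_Cnorm2_state.
- by move=> j i; apply: deg1.
by move=> k j i; apply: load1.
Qed.

Lemma progress_drop t (c : R) : (t < T)%N -> 0 < c ->
  progress t <= progress t.+1 + pair_count * (c * (l0%:R / m0%:R) + c^-1 * (l1%:R / m1%:R)).
Proof.
move=> tT c_gt0; have c_ge0 := ltW c_gt0.
have loads := lerD (ler_wpM2l c_ge0 (rejected_load (ltnW tT)))
  (ler_wpM2l (_ : 0 <= c^-1) (accepted_load (ltnW tT))).
rewrite mulrDr (mulrCA _ c) (mulrCA _ c^-1).
apply: le_trans (_ : _ <= progress t.+1 + _) _; last first.
  by rewrite lerD2l; apply: loads; rewrite invr_ge0.
rewrite /progress !big_distrr -!big_split; apply: ler_sum => i _.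
rewrite !big_distrr -!big_split; apply: ler_sum => j rij /=.
exact: (rdot_phase_run_drop U_unitary (phase_sqr (x i)) (phase_sqr (y j))).
Qed.

End Relation.

Theorem ambainis_bound : adversary_bounded (fun x (k : 'I_d) => phase x k) accepts (1296 * T ^ 2).
Proof.
move=> L0 L1 r x y m0 m1 l0 l1 [i [j rij]] sep deg0 deg1 load0 load1.
have [->//|m0_gt0] := posnP m0; have [->|m1_gt0] := posnP m1; first by rewrite muln0.
set a : R := (l0%:R / m0%:R)%R; set b : R := (l1%:R / m1%:R)%R.
set N := pair_count r.
have N_gt0 : 0 < N.
  rewrite /N /pair_count (bigD1 i) //= (bigD1 j) //=.
  by rewrite ltr_wpDr ?ltr_wpDr ?sumr_ge0 // => *; rewrite sumr_ge0.
have progress_ge (c : R) t : 0 < c -> (t <= T)%N ->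
    N - t%:R * (N * (c * a + c^-1 * b)) <= progress r x y t.
  move=> c_gt0; elim: t => [|t IH] tT; first by rewrite progress0 // mul0r subr0.
  have drop : progress r x y t <= progress r x y t.+1 + N * (c * a + c^-1 * b).
    exact: progress_drop.
  by have := IH (ltnW tT); rewrite -natr1; lra.
have lower (c : R) : 0 < c -> 1 <= c * (18 * T%:R * a) + c^-1 * (18 * T%:R * b).
  move=> c_gt0; have := progress_ge c T c_gt0 (leqnn T); have := progress_final sep.
  rewrite -/N -(ler_pM2l N_gt0); lra.
have a_ge0 : 0 <= 18 * T%:R * a by rewrite mulr_ge0 ?divr_ge0 ?mulr_ge0 ?ler0n.
have b_ge0 : 0 <= 18 * T%:R * b by rewrite mulr_ge0 ?divr_ge0 ?mulr_ge0 ?ler0n.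
have ratio_bound := AGM_optimum a_ge0 b_ge0 ler01 lower.
have m_gt0 : 0 < m0%:R * m1%:R :> R by rewrite mulr_gt0 ?ltr0n.
rewrite -(ler_nat R) !natrM.
have -> : l0%:R * l1%:R = a * b * (m0%:R * m1%:R) :> R.
  by rewrite mulf_div divfK // lt0r_neq0.
rewrite (mulrC (a * b)) -mulrA ler_pMr //.
by move: ratio_bound; rewrite expr1n; lra.
Qed.
End Ambainis.
End QuantumAlgorithms.

(** * Finite sets and permutations *)

Lemma half_le n : n./2 <= n.
Proof. by rewrite leq_half_double -addnn; lia. Qed.

Lemma card_bigcup_le (I T : finType) (A : {set I}) (B : I -> {set T}) :
  #|\bigcup_(i in A) B i| <= \sum_(i in A) #|B i|.
Proof.
elim/big_rec2: _ => [|i n U _ Un]; first by rewrite cards0.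
by apply: leq_trans (leq_card_setU _ _) _; rewrite leq_add2l.
Qed.

Lemma exists_le_mean (I : finType) (A : {set I}) (f : I -> nat) :
  A != set0 -> exists2 i, i \in A & #|A| * f i <= \sum_(j in A) f j.
Proof.
move=> /set0Pn[i0 i0A]; case: (arg_minnP f i0A) => i iA i_min.
by exists i => //; rewrite -sum_nat_const; apply: leq_sum.
Qed.

Lemma subset_of_card (T : finType) (A : {set T}) k :
  k <= #|A| -> exists2 B : {set T}, B \subset A & #|B| = k.
Proof.
rewrite -bin_gt0 -cards_draws => /card_gt0P[B].
by rewrite inE => /andP[BA /eqP Bk]; exists B.
Qed.

Lemma subset_cardS (T : finType) (A B : {set T}) :
  A \subset B -> #|B| = #|A|.+1 -> exists2 x, x \notin A & B = x |: A.
Proof.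
move=> AB cardB; have /card_gt0P[x] : 0 < #|B :\: A| by rewrite cardsD (setIidPr AB); lia.
rewrite inE => /andP[xA xB]; exists x => //; apply/eqP.
by rewrite eq_sym eqEcard subUset sub1set xB AB cardsU1 xA cardB leqnn.
Qed.

Lemma card_setD1 (T : finType) (A : {set T}) x : x \in A -> #|A :\ x| = #|A|.-1.
Proof. by move=> xA; rewrite (cardsD1 x A) xA. Qed.

Lemma ex_other (T : finType) (A : {set T}) x : 1 < #|A| -> exists2 y, y \in A & y != x.
Proof.
rewrite (cardsD1 x A) => A_gt1; have /card_gt0P[y /setD1P[yx yA]] : 0 < #|A :\ x|.
  by move: A_gt1; case: (x \in A) => //; apply: ltnW.
by exists y.
Qed.

Lemma setU1_inj (T : finType) (A : {set T}) : {in ~: A &, injective (fun x => x |: A)}.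
Proof.
move=> x y; rewrite !inE => xA yA /setP/(_ x); rewrite !inE eqxx (negbTE xA) !orbF.
by move/esym/eqP.
Qed.

Lemma setD1_inj (T : finType) (A : {set T}) : {in A &, injective (fun x => A :\ x)}.
Proof.
move=> x y xA yA /setP/(_ x); rewrite !inE eqxx xA andbT /=.
by case: (x =P y).
Qed.

Lemma leq_card_fibers (T U : finType) (A : {set T}) (f : T -> U) k :
  {in f @: A, forall y, #|[set x in A | f x == y]| <= k} -> #|A| <= #|f @: A| * k.
Proof.
move=> fiber_le; rewrite -sum1_card (partition_big_imset f) -sum_nat_const /=.
by apply: leq_sum => y /fiber_le; rewrite sum1dep_card.
Qed.

Lemma card_dpair (T U : finType) (A : {set T}) (B : T -> {set U}) :
  #|[set z : T * U | (z.1 \in A) && (z.2 \in B z.1)]| = \sum_(x in A) #|B x|.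
Proof.
under [RHS]eq_bigr => x _ do rewrite -sum1_card.
by rewrite pair_big_dep -sum1_card; apply: eq_bigl => z; rewrite inE.
Qed.

Lemma card_triples_le (T : finType) (A : {set T * (T * T)}) :
  #|A| <= #|[set [set t.1; t.2.1; t.2.2] | t : T * (T * T) in A]| * 27.
Proof.
apply: leq_card_fibers => _ /imsetP[t0 _ ->]; set e := [set t0.1; t0.2.1; t0.2.2].
have card_e : #|e| <= 3.
  by apply: leq_trans (leq_card_setU _ _) _; rewrite cards1 cards2; case: (_ != _).
apply: (@leq_trans #|setX e (setX e e)|); last first.
  by rewrite !cardsX (leq_mul card_e (leq_mul card_e card_e)).
apply/subset_leq_card/subsetP => -[y [y' y'']]; rewrite inE => /andP[_ /eqP <-].
by rewrite !inE !eqxx ?orbT.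
Qed.

Section ColorPreservingPermutations.
Variables (T : finType) (C : eqType) (col : T -> C).

Definition color_perms := [set s : {perm T} | [forall x, col (s x) == col x]].

Lemma color_permsP (s : {perm T}) : reflect (forall x, col (s x) = col x) (s \in color_perms).
Proof. by rewrite inE; apply: (iffP forallP) => s_col x; apply/eqP. Qed.

Lemma color_perms_group_set : group_set color_perms.
Proof.
apply/group_setP; split=> [|s t /color_permsP s_col /color_permsP t_col].
  by apply/color_permsP => x; rewrite perm1.
by apply/color_permsP => x; rewrite permM t_col.
Qed.

Canonical color_perms_group := Group color_perms_group_set.

Lemma tperm_color x y : col x = col y -> tperm x y \in color_perms.
Proof. by move=> xy; apply/color_permsP => z; case: tpermP => [->|->|]. Qed.

Lemma color_perm_imset (A : {set T}) (s : {perm T}) :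
  (forall x y, col x = col y -> (x \in A) = (y \in A)) -> s \in color_perms -> s @: A = A.
Proof.
move=> A_colored /color_permsP s_col; apply/setP => x; rewrite -{1}(permKV s x).
by rewrite mem_imset; [rewrite -(A_colored _ _ (s_col _)) permKV | apply: perm_inj].
Qed.

Lemma color_perm_of_seqs (s1 s2 : seq T) : uniq s1 -> uniq s2 -> map col s1 = map col s2 ->
  exists2 p : {perm T}, p \in color_perms & map p s1 = s2.
Proof.
elim/last_ind: s1 s2 => [|s1 x IH] s2.
  by case: s2 => // _ _ _; exists 1%g; rewrite ?group1.
case/lastP: s2 => [|s2 y]; first by rewrite map_rcons; case: (map _ _).
rewrite !rcons_uniq !map_rcons => /andP[xs1 s1_uniq] /andP[ys2 s2_uniq] /rcons_inj[cols colxy].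
have [p p_col ps1] := IH s2 s1_uniq s2_uniq cols.
have colpxy : col (p x) = col y by rewrite -colxy; have /color_permsP := p_col.
exists (p * tperm (p x) y)%g; first by rewrite groupM ?tperm_color.
rewrite map_rcons permM tpermL -ps1; congr rcons; apply/eq_in_map => z zs1.
rewrite permM tpermD //; first by rewrite (inj_eq perm_inj); apply: contraNneq xs1 => ->.
by apply: contraNneq ys2 => ->; rewrite -ps1 map_f.
Qed.

Definition color_class x := [set y | col y == col x].

Lemma leq_card_color_class (A : {set T}) x :
  {in A, forall y, col y = col x} -> #|A| <= #|color_class x|.
Proof.
move=> A_col; apply/subset_leq_card/subsetP => y /A_col.
by rewrite inE => ->.
Qed.

Definition colored_triples x a c : {set T * (T * T)} :=
  setX (color_class x) [set t | (t.1 \in color_class a) && (t.2 \in color_class c :\ t.1)].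

Lemma card_colored_triples x a c m :
    m <= #|color_class x| -> m <= #|color_class a| -> m <= #|color_class c| ->
  m ^ 2 * m.-1 <= #|colored_triples x a c|.
Proof.
move=> x_large a_large c_large; rewrite cardsX -mulnn -mulnA leq_mul //.
rewrite (card_dpair (color_class a) (fun y => color_class c :\ y)).
apply: (@leq_trans (\sum_(y in color_class a) m.-1)).
  by rewrite sum_nat_const leq_mul2r a_large orbT.
apply: leq_sum => y _; rewrite -subn1 leq_subLR; apply: leq_trans c_large _.
by rewrite (cardsD1 y) leq_add2r leq_b1.
Qed.

Lemma colored_triples_orbit x a c x' a' c' :
    uniq [:: x; a; c] -> col x != col a -> col x != col c ->
    (x', (a', c')) \in colored_triples x a c ->
  [set x'; a'; c'] \in orbit 'P^* color_perms [set x; a; c].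
Proof.
move=> xac_uniq xa xc; rewrite !inE /= => /and3P[/eqP x'x /eqP a'a /andP[c'a' /eqP c'c]].
have x'a' : x' != a' by apply: contraNneq xa => E; rewrite -x'x E a'a.
have x'c' : x' != c' by apply: contraNneq xc => E; rewrite -x'x E c'c.
have [||p p_col /= [<- <- <-]] := @color_perm_of_seqs [:: x; a; c] [:: x'; a'; c'] xac_uniq.
- by rewrite /= !inE !andbT negb_or x'a' x'c' eq_sym.
- by rewrite /= x'x a'a c'c.
by apply/orbitP; exists p; rewrite //= -!imset_set1 -!imsetU.
Qed.

Lemma card_color_orbit x a c m :
    uniq [:: x; a; c] -> col x != col a -> col x != col c ->
    m <= #|color_class x| -> m <= #|color_class a| -> m <= #|color_class c| ->
  m ^ 2 * m.-1 <= 27 * #|orbit 'P^* color_perms [set x; a; c]|.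
Proof.
move=> xac_uniq xa xc x_large a_large c_large.
apply: leq_trans (card_colored_triples x_large a_large c_large) _.
apply: leq_trans (card_triples_le _) _; rewrite mulnC leq_mul2l subset_leq_card //.
apply/subsetP => _ /imsetP[[x' [a' c']] x'a'c' ->].
exact: colored_triples_orbit x'a'c'.
Qed.

End ColorPreservingPermutations.

Definition pairwise_disjoint (T : finType) (As : seq {set T}) :=
  pairwise [rel A B : {set T} | [disjoint A & B]] As.

Lemma uniq_flatten_enum (T : finType) (As : seq {set T}) :
  pairwise_disjoint As -> uniq (flatten [seq enum A | A : {set T} <- As]).
Proof.
elim: As => //= A As IH /andP[/allP A_disjoint /IH]; rewrite cat_uniq enum_uniq => -> /=.
rewrite andbT; apply/hasPn => x /flattenP[_ /mapP[B /A_disjoint AB ->]]; rewrite !mem_enum => xB.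
by rewrite (disjointFl AB).
Qed.

Lemma perm_of_disjoint_sets (T : finType) (As Bs : seq {set T}) :
    pairwise_disjoint As -> pairwise_disjoint Bs ->
    [seq #|A| | A : {set T} <- As] = [seq #|B| | B : {set T} <- Bs] ->
  exists p : {perm T}, [seq p @: A | A : {set T} <- As] = Bs.
Proof.
move=> /uniq_flatten_enum As_uniq /uniq_flatten_enum Bs_uniq eq_card.
have [|p _] := color_perm_of_seqs (col := fun=> tt) As_uniq Bs_uniq.
  apply: (@eq_from_nth _ tt) => [|i _]; last by case: nth; case: nth.
  rewrite !size_map !size_flatten /shape -!map_comp; congr sumn.
  by rewrite -!(eq_map (fun A : {set T} => cardE A)).
move=> p_enum; exists p.
elim: As Bs eq_card p_enum {As_uniq Bs_uniq} => [|A As IH] [|B Bs] //= [cardA eq_card].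
rewrite map_cat => /eqP; rewrite eqseq_cat ?size_map -?cardE // => /andP[/eqP pA].
move=> /eqP/(IH _ eq_card) ->; congr (_ :: _); apply/setP => x; rewrite -[RHS]mem_enum -pA.
by apply/imsetP/mapP => -[y yA ->]; exists y; rewrite ?mem_enum // in yA *.
Qed.

(** * Hypergraphs and transversals *)

Section Hypergraphs.
Variable V : finType.
Implicit Types (E F : {set {set V}}) (A C e : {set V}) (s : {perm V}).

Definition uniform r F : Prop := forall e, e \in F -> #|e| = r.

Definition edge_query r E e : bool := (#|e| == r) && (e \in E).

Definition embeds F E : bool := [exists s : {perm V}, [forall e in F, s @: e \in E]].

Lemma uniform_set0 r F : uniform r F -> 0 < r -> set0 \notin F.
Proof.
move=> F_uniform r_gt0; apply/negP => /F_uniform r0.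
by rewrite -r0 cards0 in r_gt0.
Qed.

Lemma embedsP F E : reflect (exists s : {perm V}, forall e, e \in F -> s @: e \in E) (embeds F E).
Proof.
apply: (iffP existsP) => -[s sP]; exists s; last exact/forall_inP.
by move/forall_inP: sP.
Qed.

Lemma card_perm_imset s e : #|s @: e| = #|e|.
Proof. exact: card_imset perm_inj. Qed.

Lemma perm_imsetM s t e : (s * t)%g @: e = t @: (s @: e).
Proof. by rewrite -imset_comp; apply: eq_imset => x; rewrite /= permM. Qed.

Lemma perm_imsetKV s e : s @: (s^-1%g @: e) = e.
Proof. by rewrite -perm_imsetM mulVg imset_perm1. Qed.

Lemma mem_perm_imset s A x : (x \in s @: A) = (s^-1%g x \in A).
Proof. by rewrite -{1}(permKV s x) mem_imset //; apply: perm_inj. Qed.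

Lemma perm_imsetD1 s e x : s @: e :\ s x = s @: (e :\ x).
Proof. by apply/setP => y; rewrite !(inE, mem_perm_imset) (can2_eq (permKV s) (permK s)). Qed.

Definition relabel s E := [set s @: e | e : {set V} in E].

Lemma mem_relabel s E e : (s @: e \in relabel s E) = (e \in E).
Proof. by rewrite mem_imset //; apply/imset_inj/perm_inj. Qed.

Lemma relabelU s E E' : relabel s (E :|: E') = relabel s E :|: relabel s E'.
Proof. exact: imsetU. Qed.

Lemma relabel_eq s E E' : (forall e, (s @: e \in E') = (e \in E)) -> relabel s E = E'.
Proof. by move=> EE'; apply/setP => e; rewrite -(perm_imsetKV s e) mem_relabel EE'. Qed.

Lemma embeds_relabel s F E : embeds F (relabel s E) = embeds F E.
Proof.
apply/embedsP/embedsP => -[t tP]; last first.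
  by exists (t * s)%g => e /tP; rewrite perm_imsetM mem_relabel.
exists (t * s^-1)%g => e /tP; rewrite perm_imsetM.
by rewrite -{1}(perm_imsetKV s (t @: e)) mem_relabel.
Qed.

Lemma embeds_refl F : embeds F F.
Proof. by apply/embedsP; exists 1%g => e; rewrite imset_perm1. Qed.

Lemma embeds_mono r F E E' : uniform r F ->
  (forall e, #|e| = r -> e \in E -> e \in E') -> embeds F E -> embeds F E'.
Proof.
move=> F_uniform EE' /embedsP[s sE]; apply/embedsP; exists s => e eF.
by apply: EE'; [rewrite card_perm_imset F_uniform | apply: sE].
Qed.

Lemma embeds_card F E : embeds F E -> #|F| <= #|E|.
Proof.
move=> /embedsP[s sE]; rewrite -(card_imset _ (imset_inj (@perm_inj _ s))).
by apply/subset_leq_card/subsetP => _ /imsetP[e eF ->]; apply: sE.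
Qed.

Definition meeting A : {set {set V}} := [set e : {set V} | e :&: A != set0].

Lemma meetingP A e : reflect (exists2 x, x \in e & x \in A) (e \in meeting A).
Proof.
rewrite inE; apply: (iffP (set0Pn _)) => [[x /setIP[xe xA]]|[x xe xA]]; exists x => //.
by rewrite inE xe.
Qed.

Lemma relabel_meeting s A : relabel s (meeting A) = meeting (s @: A).
Proof.
apply: relabel_eq => e; rewrite !inE -imsetI ?imset_eq0 //.
by move=> x y _ _; apply: perm_inj.
Qed.

Definition transversal_number F := #|[arg min_(C < [set: V] | F \subset meeting C) #|C|]|.

Lemma transversal_number_le F C : F \subset meeting C -> transversal_number F <= #|C|.
Proof.
move=> FC; rewrite /transversal_number; case: arg_minnP => [|D _]; last exact.
apply: subset_trans FC _; apply/subsetP => e /meetingP[x xe _].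
by apply/meetingP; exists x; rewrite ?inE.
Qed.

Lemma minimum_transversal F :
  set0 \notin F -> exists2 C, F \subset meeting C & #|C| = transversal_number F.
Proof.
move=> set0NF; rewrite /transversal_number; case: arg_minnP => [|D FD _]; last by exists D.
apply/subsetP => e eF; have /set0Pn[x xe] : e != set0 by apply: contraNneq set0NF => <-.
by apply/meetingP; exists x; rewrite ?inE.
Qed.

Lemma transversal_number_gt0 F : set0 \notin F -> F != set0 -> 0 < transversal_number F.
Proof.
move=> /minimum_transversal[C FC <-] /set0Pn[e /(subsetP FC)/meetingP[x _ xC]].
by apply/card_gt0P; exists x.
Qed.

Lemma embeds_meeting F A : set0 \notin F -> embeds F (meeting A) = (transversal_number F <= #|A|).
Proof.
move=> /minimum_transversal[C FC Ctau]; apply/embedsP/idP => [[s sF]|].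
  rewrite -(card_perm_imset s^-1%g A); apply/transversal_number_le/subsetP => e /sF.
  move=> /meetingP[_ /imsetP[x xe ->] sxA].
  by apply/meetingP; exists x => //; rewrite mem_perm_imset invgK.
rewrite -Ctau => /subset_of_card[B BA cardB].
have [//|//||s [sC]] := @perm_of_disjoint_sets _ [:: C] [:: B]; first by rewrite /= cardB.
exists s => e /(subsetP FC)/meetingP[x xe xC]; apply/meetingP; exists (s x); rewrite ?imset_f //.
by rewrite (subsetP BA) // -sC imset_f.
Qed.
End Hypergraphs.

(** * Minterms, vertex thresholds and sparse vertex subsets *)

Section GeneralBounds.
Variables (V : finType) (r : nat) (F : {set {set V}}) (q : nat).
Hypotheses (F_uniform : uniform r F) (F_bounded : adversary_bounded (edge_query r) (embeds F) q).
Implicit Types (A B S e : {set V}).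
Local Notation n := #|V|.
Local Notation tau := (transversal_number F).

Lemma card_edges_le : #|F| <= q.
Proof.
have [->|/card_gt0P[e0 e0F]] := posnP #|F|; first by [].
have := @F_bounded {set V} unit (fun e _ => e \in F) (fun e => F :\ e) (fun=> F) 1 #|F| 1 1.
rewrite !mul1n; apply=> [|e _ eF|e u eF|_ [] _|e x u xF|e x u xF].
- by exists e0, tt.
- split; last exact: embeds_refl.
  by move/embeds_card; rewrite [X in X <= _](cardsD1 e) eF ltnn.
- by apply/card_gt0P; exists u; rewrite inE.
- by apply/subset_leq_card/subsetP => e eF; rewrite inE.
- by rewrite (leq_trans (max_card _)) // card_unit.
rewrite -(cards1 e); apply/subset_leq_card/subsetP => y; rewrite !inE => /andP[_].
by apply: contraNT => ye; rewrite /edge_query !inE [e == y]eq_sym ye.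
Qed.

Lemma card_le_of_edge (L : finType) (D : {set L}) (f : V -> L) k e :
  (forall j, j \in D -> #|e| = k /\ exists2 x, x \in e & j = f x) -> #|D| <= k.
Proof.
move=> DP; have [->|[j /DP[<- _]]] := set_0Vmem D; first by rewrite cards0.
apply: leq_trans (leq_imset_card f _); apply/subset_leq_card/subsetP => i /DP[_ [x xe ->]].
exact: imset_f.
Qed.

Definition adds_vertex k A B := [&& A \subset B, #|A|.+1 == k & #|B| == k].

Lemma adds_vertexP k A B :
  reflect [/\ #|A|.+1 = k, #|B| = k & exists2 x, x \notin A & B = x |: A] (adds_vertex k A B).
Proof.
apply: (iffP and3P) => [[AB /eqP Ak /eqP Bk]|[-> Bk [x xA BE]]].
  by split=> //; apply: subset_cardS; rewrite // Bk.
by rewrite Bk BE subsetUr.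
Qed.

Lemma adds_vertex_setD1 k B x : #|B| = k -> x \in B -> adds_vertex k (B :\ x) B.
Proof.
move=> Bk xB; apply/adds_vertexP; split; rewrite // -?Bk; first by rewrite [RHS](cardsD1 x) xB.
by exists x; rewrite ?setD1K // !inE eqxx.
Qed.

Lemma adds_vertex_row k A B : adds_vertex k A B ->
  (n - k).+1 <= #|[set B' | adds_vertex k A B']|.
Proof.
move=> /adds_vertexP[Ak Bk _]; have -> : (n - k).+1 = #|~: A|.
  by have := cardsC A; have := max_card (mem B); rewrite Bk; lia.
rewrite -(card_in_imset (@setU1_inj _ A)); apply/subset_leq_card/subsetP => _ /imsetP[x + ->].
by rewrite !inE => xA; apply/adds_vertexP; split=> //; [rewrite cardsU1 xA | exists x].
Qed.

Lemma adds_vertex_column k A B : adds_vertex k A B -> k <= #|[set A' | adds_vertex k A' B]|.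
Proof.
move=> /adds_vertexP[_ Bk _]; rewrite -{1}Bk -(card_in_imset (@setD1_inj _ B)).
apply/subset_leq_card/subsetP => _ /imsetP[x xB ->].
by rewrite inE adds_vertex_setD1.
Qed.

Lemma adds_vertex_differ k A B e : adds_vertex k A B ->
    edge_query r (meeting A) e != edge_query r (meeting B) e ->
  #|e| = r /\ exists x, [/\ x \in e, B = x |: A & A = B :\ x].
Proof.
move=> /adds_vertexP[_ _ [x xA ->]]; rewrite /edge_query; case: (#|e| =P r) => //= er neq.
split=> //; exists x; rewrite setU1K //; split=> //; apply: contraNT neq => xe.
apply/eqP; rewrite !inE; congr (~~ (_ == _)).
by apply/setP => y; rewrite !inE; case: eqP => // ->; rewrite (negbTE xe).
Qed.

Lemma transversal_number_threshold : set0 \notin F -> (n - tau).+1 * tau <= r ^ 2 * q.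
Proof.
move=> set0NF; have [tau0|tau_gt0] := posnP tau; first by rewrite {2}tau0 muln0.
rewrite -mulnn; apply: (F_bounded (r := adds_vertex tau) (x := @meeting V) (y := @meeting V)).
- have [B _ B_tau] := minimum_transversal set0NF; have /card_gt0P[x xB] : 0 < #|B| by rewrite B_tau.
  by exists (B :\ x), B; apply: adds_vertex_setD1.
- move=> A B /adds_vertexP[A_tau B_tau _].
  by rewrite !embeds_meeting // B_tau -A_tau ltnn leqnn.
- exact: adds_vertex_row.
- exact: adds_vertex_column.
- move=> e A B _; apply: (@card_le_of_edge _ _ (fun x => x |: A) _ e) => B'.
  rewrite inE => /andP[/adds_vertex_differ differ /differ[-> [x [xe BE _]]]].
  by split=> //; exists x.
move=> e A B _; apply: (@card_le_of_edge _ _ (fun x => B :\ x) _ e) => A'.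
rewrite inE => /andP[/adds_vertex_differ differ /differ[-> [x [xe _ AE]]]].
by split=> //; exists x.
Qed.

Lemma sum_card_sub_setD1 S :
  \sum_(u in S) #|F ::&: (S :\ u)| = (#|S| - r) * #|F ::&: S|.
Proof.
transitivity (\sum_(u in S) \sum_(e in F ::&: S) (u \notin e)).
  apply: eq_bigr => u _; rewrite -sum1_card big_mkcond [RHS]big_mkcond /=.
  apply: eq_bigr => e _; rewrite !inE subsetD1.
  by case: (e \in F); case: (e \subset S); case: (u \in e).
rewrite exchange_big /= mulnC -sum_nat_const; apply: eq_bigr => e.
rewrite inE => /andP[/F_uniform <- eS].
have -> : #|S| - #|e| = #|S :\: e| by rewrite cardsD (setIidPr eS).
rewrite -sum1_card big_mkcond [RHS]big_mkcond; apply: eq_bigr => u _.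
by rewrite !inE; case: (u \in S); case: (u \in e).
Qed.

Lemma sparse_subset m : m <= n ->
  exists2 S : {set V}, #|S| = m & #|F ::&: S| * n ^_ r <= #|F| * m ^_ r.
Proof.
move=> m_le; rewrite -(subKn m_le); have := leq_subr m n; move: (n - m) => k {m m_le}.
elim: k => [|k IH] kn.
  exists [set: V]; first by rewrite cardsT subn0.
  rewrite subn0 leq_mul2r subset_leq_card ?orbT //.
  by apply/subsetP => e; rewrite inE => /andP[].
have [S cardS S_sparse] := IH (ltnW kn).
have cardS_succ : #|S| = (n - k.+1).+1 by rewrite cardS; lia.
have [|u uS u_mean] := exists_le_mean (A := S) (fun u => #|F ::&: (S :\ u)|).
  by rewrite -card_gt0 cardS_succ.
exists (S :\ u); first by rewrite card_setD1 // cardS_succ.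
rewrite sum_card_sub_setD1 in u_mean.
rewrite -(@leq_pmul2l #|S|) ?cardS_succ // -cardS_succ mulnA.
apply: leq_trans (leq_mul u_mean (leqnn _)) _; rewrite -mulnA.
apply: leq_trans (leq_mul (leqnn _) S_sparse) _.
rewrite eq_leq // -cardS cardS_succ [RHS]mulnCA -ffactSS ffactnSr [LHS]mulnCA.
by rewrite [(_ - r) * _]mulnC.
Qed.

Lemma transversal_number_le_sub S : set0 \notin F -> tau <= #|~: S| + #|F ::&: S|.
Proof.
move=> set0NF; pose some_vertex e := [pick x in e].
pose C := [set x | Some x \in some_vertex @: (F ::&: S)].
apply: leq_trans (@transversal_number_le _ F (~: S :|: C) _) _.
  apply/subsetP => e eF; apply/meetingP.
  have [eS|/subsetPn[x xe xS]] := boolP (e \subset S); last by exists x; rewrite // !inE xS.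
  case eE: (some_vertex e) => [x|].
    exists x; first by move: eE; rewrite /some_vertex; case: pickP => // y ye [<-].
    by rewrite !inE -eE imset_f ?orbT // inE eF.
  have /set0Pn[x xe] : e != set0 by apply: contraNneq set0NF => <-.
  by move: eE; rewrite /some_vertex; case: pickP => // /(_ x); rewrite xe.
apply: leq_trans (leq_card_setU _ _) _; rewrite leq_add2l.
apply: leq_trans (leq_imset_card some_vertex _).
rewrite -(card_imset _ (@Some_inj _)); apply/subset_leq_card/subsetP => _ /imsetP[x + ->].
by rewrite inE.
Qed.
End GeneralBounds.

Lemma cube_le_ffact3 n : 3 <= n -> 2 * n ^ 3 <= 9 * n ^_ 3.
Proof.
case: n => [|[|[|k]]] // _; rewrite !ffactnS ffactn0 !expnS expn0 /=; nia.
Qed.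

Section LargeTransversalNumber.
Variables (V : finType) (F : {set {set V}}) (q : nat).
Hypotheses (F_uniform : uniform 3 F) (F_bounded : adversary_bounded (edge_query 3) (embeds F) q).
Local Notation n := #|V|.
Local Notation tau := (transversal_number F).
Local Notation codim := (n - tau).

Lemma cube_le_card_edges : 2 * codim + 3 <= n -> n ^ 3 <= 36 * #|F| * codim.+1 ^ 2.
Proof.
move=> small_codim; have set0NF := uniform_set0 F_uniform isT.
have [S cardS S_sparse] := sparse_subset F_uniform small_codim.
have S_edges : codim + 3 <= #|F ::&: S|.
  by have := transversal_number_le_sub S set0NF; have := cardsC S; lia.
have ffact_le : n ^_ 3 <= 8 * #|F| * codim.+1 ^ 2.
  rewrite -(@leq_pmul2l (codim + 3)); last by lia.
  apply: leq_trans (leq_mul S_edges (leqnn _)) _; apply: leq_trans S_sparse _.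
  rewrite (_ : _ * (8 * _ * _) = #|F| * (8 * (codim + 3) * codim.+1 ^ 2)); last by lia.
  by rewrite leq_mul2l !ffactnS ffactn0 !expnS expn0; apply/orP; right; nia.
have := cube_le_ffact3 (leq_trans _ small_codim); rewrite leq_addl => /(_ isT); lia.
Qed.

Lemma large_transversal_number_bound :
  3 <= n -> 0 < #|F| -> n <= 100 * tau -> n ^ 5 <= (1800 * q) ^ 3.
Proof.
move=> n_ge3 F_gt0 n_le; have F_le := card_edges_le F_bounded.
have codim_le : n * codim.+1 <= 900 * q.
  have := transversal_number_threshold F_bounded (uniform_set0 F_uniform isT); nia.
have [small_codim|large_codim] := leqP (2 * codim + 3) n.
  apply: (@leq_trans (36 * q * (900 * q) ^ 2)).
    have -> : n ^ 5 = n ^ 3 * n ^ 2 by rewrite -expnD.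
    apply: leq_trans (leq_mul (cube_le_card_edges small_codim) (leqnn _)) _.
    rewrite -mulnA -expnMn [codim.+1 * n]mulnC leq_mul ?leq_sqr //.
    by rewrite leq_mul2l F_le.
  rewrite expnMn; lia.
have n2_le : n ^ 2 <= 1800 * q by nia.
apply: (@leq_trans ((n ^ 2) ^ 3)); first by rewrite -expnM leq_pexp2l //; lia.
by rewrite leq_exp2r.
Qed.
End LargeTransversalNumber.

(** * Star configurations *)

Lemma edge_query_setU (V : finType) r (b E E' : {set {set V}}) e :
  edge_query r (b :|: E) e != edge_query r (b :|: E') e -> (e \in E) != (e \in E').
Proof. by rewrite /edge_query !in_setU; case: (#|e| == r); case: (e \in b). Qed.

Section StarConfigurations.
Variable V : finType.
Local Notation config := {ffun V -> {set {set V}}}.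
Implicit Types (g : config) (L : {set {set V}}) (X Y e : {set V}) (x y : V).

Definition pairs Y : {set {set V}} := [set w : {set V} | (w \subset Y) && (#|w| == 2)].

(* [g x] is the link of the centre [x]. *)
Definition stars g : {set {set V}} := [set e : {set V} | [exists x in e, e :\ x \in g x]].

Definition centers g := [set x | g x != set0].

Definition star_config X Y g := (centers g \subset X) && [forall x, g x \subset pairs Y].

Definition full_config X Y : config := [ffun x => if x \in X then pairs Y else set0].

Definition relink g x L : config := [ffun y => if y == x then L else g y].

Definition swap x y g : config := [ffun z => g (tperm x y z)].

Definition relabel_config s g : config := [ffun x => relabel s (g (s^-1%g x))].

Lemma starsP g e : reflect (exists2 x, x \in e & e :\ x \in g x) (e \in stars g).
Proof. by rewrite inE; apply: exists_inP. Qed.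

Lemma star_configP X Y g :
  reflect (centers g \subset X /\ forall x, g x \subset pairs Y) (star_config X Y g).
Proof. by apply: (iffP andP) => -[gX /forallP]. Qed.

Lemma stars_mono g g' : (forall x, g x \subset g' x) -> stars g \subset stars g'.
Proof.
move=> gg'; apply/subsetP => e /starsP[x xe ex].
by apply/starsP; exists x; rewrite ?(subsetP (gg' x)).
Qed.

Lemma card_stars_le g d : (forall x, #|g x| <= d) -> #|stars g| <= #|centers g| * d.
Proof.
move=> g_le; pose star x := [set x |: w | w : {set V} in g x].
have covered : stars g \subset \bigcup_(x in centers g) star x.
  apply/subsetP => e /starsP[x xe ex]; apply/bigcupP; exists x.
    by rewrite inE; apply/set0Pn; exists (e :\ x).
  by rewrite -(setD1K xe) imset_f.
apply: leq_trans (subset_leq_card covered) _; apply: leq_trans (card_bigcup_le _ _) _.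
rewrite -sum_nat_const; apply: leq_sum => x _.
exact: leq_trans (leq_imset_card _ _) (g_le x).
Qed.

Lemma star_config_full X Y : star_config X Y (full_config X Y).
Proof.
apply/star_configP; split=> [|x]; last by rewrite ffunE; case: ifP; rewrite ?sub0set.
by apply/subsetP => x; rewrite inE ffunE; case: ifP; rewrite ?eqxx.
Qed.

Lemma relink_same g x L : relink g x L x = L.
Proof. by rewrite ffunE eqxx. Qed.

Lemma relink_other g x y L : y != x -> relink g x L y = g y.
Proof. by move=> yx; rewrite ffunE (negbTE yx). Qed.

Lemma relink_relink g x L L' : relink (relink g x L) x L' = relink g x L'.
Proof. by apply/ffunP => y; rewrite !ffunE; case: eqP. Qed.

Lemma relink_id g x : relink g x (g x) = g.
Proof. by apply/ffunP => y; rewrite !ffunE; case: eqP => // ->. Qed.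

Lemma relink_inj g x y L : g x != L -> relink g x L = relink g y L -> x = y.
Proof.
move=> gxL /ffunP/(_ x); rewrite relink_same ffunE; case: (x =P y) => // _ LE.
by rewrite -LE eqxx in gxL.
Qed.

Lemma star_config_relink X Y g x L : star_config X Y g -> x \in X -> L \subset pairs Y ->
  star_config X Y (relink g x L).
Proof.
move=> /star_configP[gX gY] xX LY; apply/star_configP; split=> [|y]; last first.
  by rewrite ffunE; case: ifP.
apply/subsetP => y; rewrite inE ffunE; case: (y =P x) => [-> //|_ gy].
by rewrite (subsetP gX) // inE.
Qed.

Lemma centers_remove g x : centers (relink g x set0) = centers g :\ x.
Proof. by apply/setP => y; rewrite !inE ffunE; case: (y =P x); rewrite ?eqxx. Qed.

Lemma centers_swap x y g : centers (swap x y g) = tperm x y @: centers g.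
Proof. by apply/setP => z; rewrite mem_perm_imset tpermV !inE ffunE. Qed.

Lemma swap_relink g x y :
  y = x \/ y \notin centers g -> swap x y g = relink (relink g x set0) y (g x).
Proof.
move=> y_free; apply/ffunP => z; rewrite !ffunE.
case: tpermP => [->|->|/eqP/negbTE zx /eqP/negbTE zy]; first 2 last.
- by rewrite zx zy.
- case: (x =P y) => [<- //|xy]; rewrite eqxx.
  by case: y_free => [/esym //|]; rewrite inE negbK => /eqP.
by rewrite eqxx.
Qed.

Lemma star_config_swap X Y g x y :
  x \in X -> y \in X -> star_config X Y g -> star_config X Y (swap x y g).
Proof.
move=> xX yX /star_configP[gX gY]; apply/star_configP; split=> [|z]; last by rewrite ffunE.
rewrite centers_swap; apply/subsetP => _ /imsetP[z /(subsetP gX) zX ->].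
by case: tpermP.
Qed.

Lemma relabel_stars s g : relabel s (stars g) = stars (relabel_config s g).
Proof.
apply: relabel_eq => e; apply/starsP/starsP => [[_ /imsetP[x xe ->]]|[x xe ex]].
  by rewrite perm_imsetD1 ffunE permK mem_relabel; exists x.
by exists (s x); rewrite ?imset_f // perm_imsetD1 ffunE permK mem_relabel.
Qed.

Lemma relabel_pairs s Y : relabel s (pairs Y) = pairs (s @: Y).
Proof.
apply: relabel_eq => w; rewrite !inE card_perm_imset; congr (_ && _).
apply/subsetP/subsetP => wY x xw; last by move: xw => /imsetP[y yw ->]; rewrite imset_f ?wY.
by rewrite -(mem_imset _ _ (@perm_inj _ s)) wY ?imset_f.
Qed.

Lemma relabel_full_config s X Y :
  relabel_config s (full_config X Y) = full_config (s @: X) (s @: Y).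
Proof.
apply/ffunP => x; rewrite !ffunE mem_perm_imset; case: ifP => _; first exact: relabel_pairs.
by rewrite /relabel imset0.
Qed.

Lemma relabel_tperm_config X Y g x y :
    [disjoint X & Y] -> x \in X -> y \in X -> star_config X Y g ->
  relabel_config (tperm x y) g = swap x y g.
Proof.
move=> XY xX yX /star_configP[_ gY]; apply/ffunP => z; rewrite !ffunE tpermV.
rewrite /relabel -[RHS]imset_id; apply: eq_in_imset => w /(subsetP (gY _)).
rewrite inE => /andP[/subsetP wY _]; rewrite -[RHS]imset_id; apply: eq_in_imset => i /wY iY.
by rewrite tpermD //; apply: contraTneq iY => <-; rewrite (disjointFr XY).
Qed.

Lemma center_unique X Y e x y :
  [disjoint X & Y] -> e :\ x \in pairs Y -> y \in e -> y \in X -> y = x.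
Proof.
move=> XY; rewrite inE => /andP[/subsetP eY _] ye yX.
apply/eqP; apply: contraFT (disjointFr XY yX) => yx.
by rewrite eY // !inE yx.
Qed.

Lemma stars_relink_neq g x L e : (e \in stars g) != (e \in stars (relink g x L)) ->
  x \in e /\ (e :\ x \in g x) != (e :\ x \in L).
Proof.
move=> neq; apply/andP; apply: contraNT neq; rewrite negb_and negbK => x_indep.
rewrite !inE; apply/eqP/eq_existsb => y; rewrite ffunE; case: (y =P x) => // ->.
by move: x_indep; case: (x \in e) => //= /eqP.
Qed.

Lemma ex_largest_link g :
  centers g != set0 -> exists2 v, v \in centers g & forall x, #|g x| <= #|g v|.
Proof.
case/set0Pn => v0 v0_center.
have [v v_center v_max] := arg_maxnP (fun x => #|g x|) v0_center; exists v => // x.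
have [/v_max //|] := boolP (x \in centers g).
by rewrite inE negbK => /eqP ->; rewrite cards0.
Qed.

(* The base [#|V|.+1] makes one link of size [d + 1] outweigh any number of links of size [d]. *)
Definition potential g := \sum_(x in centers g) #|V|.+1 ^ #|g x|.

Lemma potential_swap x y g : potential (swap x y g) = potential g.
Proof.
rewrite /potential [RHS](reindex_inj (@perm_inj _ (tperm x y))) /=.
by apply: eq_big => z; rewrite ?inE ffunE.
Qed.

Lemma potential_remove g x : x \in centers g -> potential (relink g x set0) < potential g.
Proof.
move=> xg; rewrite /potential centers_remove [X in _ < X](big_setD1 x xg) /=.
rewrite -[X in X < _]add0n -addSn leq_add ?expn_gt0 // leq_eqVlt; apply/orP; left; apply/eqP.
by apply: eq_bigr => y; rewrite !inE => /andP[yx _]; rewrite relink_other.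
Qed.

End StarConfigurations.

Section ExtremalConfigurations.
Variables (V : finType) (F : {set {set V}}) (q : nat) (b : {set {set V}}) (X Y : {set V}) (h : nat).
Hypotheses (F_uniform : uniform 3 F) (F_bounded : adversary_bounded (edge_query 3) (embeds F) q).
Hypothesis XY_disjoint : [disjoint X & Y].
Hypothesis b_tperm : {in X &, forall x y, relabel (tperm x y) b = b}.
Local Notation config := {ffun V -> {set {set V}}}.
Implicit Types (g : config) (L : {set {set V}}) (e : {set V}) (x y : V).

Definition accepted g := [&& star_config X Y g, #|centers g| <= h & embeds F (b :|: stars g)].

Definition extremal g := accepted g && [forall g', accepted g' ==> (potential g <= potential g')].

Lemma ex_extremal g : accepted g -> exists g', extremal g'.
Proof.
move=> /(arg_minnP (@potential V))[g' acc g'_min]; exists g'.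
by rewrite /extremal acc; apply/forall_inP.
Qed.

Lemma extremal_min g g' : extremal g -> star_config X Y g' -> #|centers g'| <= h ->
  potential g' < potential g -> ~~ embeds F (b :|: stars g').
Proof.
move=> /andP[_ /forall_inP g_min] g'_valid g'_few; rewrite ltnNge; apply: contra => g'_emb.
by apply: g_min; rewrite /accepted g'_valid g'_few.
Qed.

Lemma extremal_remove g x :
  extremal g -> x \in centers g -> ~~ embeds F (b :|: stars (relink g x set0)).
Proof.
move=> g_ext xg; have /andP[/and3P[g_valid g_few _] _] := g_ext.
have xX : x \in X by have /star_configP[gX _] := g_valid; apply: (subsetP gX).
apply: (extremal_min g_ext); rewrite ?star_config_relink ?sub0set ?potential_remove //.
by rewrite centers_remove; apply: leq_trans g_few; rewrite subset_leq_card ?subsetDl.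
Qed.

Lemma embeds_swap g x y : star_config X Y g -> x \in X -> y \in X ->
  embeds F (b :|: stars (swap x y g)) = embeds F (b :|: stars g).
Proof.
move=> g_valid xX yX; rewrite -(embeds_relabel (tperm x y) F (b :|: stars g)).
by rewrite relabelU b_tperm // relabel_stars (relabel_tperm_config XY_disjoint).
Qed.

Lemma extremal_swap g x y : x \in X -> y \in X -> extremal g -> extremal (swap x y g).
Proof.
move=> xX yX /andP[/and3P[g_valid g_few g_emb] g_min].
rewrite /extremal /accepted star_config_swap // centers_swap card_perm_imset g_few.
by rewrite embeds_swap // g_emb potential_swap.
Qed.

Lemma relink_query_neq g x L e : star_config X Y g -> L \subset pairs Y ->
    edge_query 3 (b :|: stars g) e != edge_query 3 (b :|: stars (relink g x L)) e ->
  [/\ x \in e, e :\ x \in pairs Y & (e :\ x \in g x) != (e :\ x \in L)].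
Proof.
move=> /star_configP[_ gY] LY /edge_query_setU/stars_relink_neq[xe neq]; split=> //.
case: (boolP (e :\ x \in L)) neq => [/(subsetP LY) //|_].
by case: (boolP (_ \in g x)) => // /(subsetP (gY x)).
Qed.

(* As the removed link is recorded, the accepted neighbours of [z] only differ in its position. *)
Definition removes_center k (z : config * {set {set V}}) g :=
  [&& extremal g, #|centers g| == k & [exists x in centers g, z == (relink g x set0, g x)]].

Lemma removes_centerP k z g : reflect
  [/\ extremal g, #|centers g| = k & exists2 x, x \in centers g & z = (relink g x set0, g x)]
  (removes_center k z g).
Proof.
apply: (iffP and3P) => [[g_ext /eqP gk /exists_inP[x xg /eqP zE]]|[g_ext -> [x xg zE]]].
  by split=> //; exists x.
by split=> //; apply/exists_inP; exists x => //; apply/eqP.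
Qed.

Lemma extremal_star_config g : extremal g -> star_config X Y g.
Proof. by case/andP => /and3P[]. Qed.

Lemma extremal_center g x : extremal g -> x \in centers g -> x \in X.
Proof. by case/andP => /and3P[/star_configP[gX _] _ _] _; apply: (subsetP gX). Qed.

Lemma removes_center_differ k z g e : removes_center k z g ->
    edge_query 3 (b :|: stars z.1) e != edge_query 3 (b :|: stars g) e ->
  exists x, [/\ x \in X, x \in e, e :\ x \in pairs Y & z = (relink g x set0, g x)].
Proof.
move=> /removes_centerP[g_ext _ [x xg ->]]; rewrite eq_sym.
move=> /(relink_query_neq (extremal_star_config g_ext) (sub0set _))[xe ex _].
by exists x; rewrite (extremal_center g_ext xg).
Qed.

Lemma removes_center_row k z g : removes_center k z g ->
  (#|X| - k).+1 <= #|[set g' | removes_center k z g']|.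
Proof.
move=> /removes_centerP[g_ext gk [x xg ->]]; set g0 := relink g x set0.
have gX : centers g \subset X by apply/subsetP => y; apply: extremal_center.
have gx_neq0 : g x != set0 by rewrite inE in xg.
have card_free : #|X :\: centers g0| = (#|X| - k).+1.
  rewrite cardsD centers_remove (setIidPr (subset_trans (subsetDl _ _) gX)).
  by have := cardsD1 x (centers g); have := subset_leq_card gX; rewrite xg gk; lia.
have free_empty y : y \in X :\: centers g0 -> g0 y = set0.
  by rewrite !in_setD [y \in centers _]inE negbK => /andP[/eqP].
rewrite -card_free -(card_in_imset (f := fun y => relink g0 y (g x))); last first.
  by move=> y y' /free_empty y0 _; apply: relink_inj; rewrite y0 eq_sym.
apply/subset_leq_card/subsetP => _ /imsetP[y y_free ->]; rewrite inE.
have yE : y = x \/ y \notin centers g.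
  move: y_free; rewrite centers_remove in_setD in_setD1 negb_and negbK.
  by move=> /andP[/orP[/eqP|]]; [left|right].
have yX : y \in X by move: y_free => /setDP[].
rewrite -swap_relink //; apply/removes_centerP; split.
- exact: extremal_swap (extremal_center g_ext xg) yX g_ext.
- by rewrite centers_swap card_perm_imset.
exists y; first by rewrite centers_swap mem_perm_imset tpermV tpermR.
have relink_g0 : relink g0 y set0 = g0 by rewrite -[X in relink _ _ X](free_empty y) // relink_id.
by rewrite swap_relink // relink_relink relink_same relink_g0.
Qed.

Lemma removes_center_column k z g : removes_center k z g ->
  k <= #|[set z' | removes_center k z' g]|.
Proof.
move=> /removes_centerP[g_ext gk _].
rewrite -{1}gk -(card_in_imset (f := fun x => (relink g x set0, g x))); last first.
  by move=> x y; rewrite inE => gx _ [/(relink_inj gx)].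
apply/subset_leq_card/subsetP => _ /imsetP[x xg ->]; rewrite inE.
by apply/removes_centerP; split=> //; exists x.
Qed.

Lemma center_move_bound g : extremal g -> (#|X| - #|centers g|).+1 * #|centers g| <= q.
Proof.
move=> g_ext; set k := #|centers g|; have [->|k_gt0] := posnP k; first by rewrite muln0.
have := @F_bounded _ _ (removes_center k) (fun z => b :|: stars z.1) (fun g => b :|: stars g)
  (#|X| - k).+1 k 1 1; rewrite !mul1n; apply.
- have /card_gt0P[x xg] := k_gt0.
  by exists (relink g x set0, g x), g; apply/removes_centerP; split=> //; exists x.
- move=> z g' /removes_centerP[g'_ext _ [x xg ->]].
  by split; [exact/negP/(extremal_remove g'_ext) | have /andP[/and3P[]] := g'_ext].
- exact: removes_center_row.
- exact: removes_center_column.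
- move=> e z _ _; apply/card_le1_eqP => g1 g2; rewrite !inE => /andP[rem1 neq1] /andP[rem2 neq2].
  have [x [xX xe _ zE1]] := removes_center_differ rem1 neq1.
  have [y [_ _ ey zE2]] := removes_center_differ rem2 neq2.
  have xy := center_unique XY_disjoint ey xe xX; move: zE1; rewrite zE2 xy => -[removedE linkE].
  rewrite -[g1](relink_id _ y) -[g2](relink_id _ y) linkE.
  by rewrite -(relink_relink g1 y set0) -removedE relink_relink.
move=> e _ g' _; apply/card_le1_eqP => z1 z2; rewrite !inE => /andP[rem1 neq1] /andP[rem2 neq2].
have [x [xX xe _ ->]] := removes_center_differ rem1 neq1.
have [y [_ _ ey ->]] := removes_center_differ rem2 neq2.
by rewrite (center_unique XY_disjoint ey xe xX).
Qed.

Section LinkLowering.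
Variables (g : config) (v : V) (J : {set V}).
Hypotheses (g_ext : extremal g) (v_center : v \in centers g) (vJ : v \in J) (JX : J \subset X).
Hypothesis J_empty : {in J, forall x, x != v -> g x = set0}.
Hypothesis J_small : #|J :|: centers g| <= h.
Local Notation L := (g v).
Implicit Types (u : config).

Definition lowered u :=
  [forall x, if x \in J then (u x \subset L) && (#|u x|.+1 == #|L|) else u x == g x].

Definition raises_link u u' := lowered u && [exists x in J, u' == relink u x L].

Lemma loweredP u : reflect
  ({in J, forall x, u x \subset L /\ #|u x|.+1 = #|L|} /\ forall x, x \notin J -> u x = g x)
  (lowered u).
Proof.
apply: (iffP forallP) => [u_low|[uJ uNJ] x]; last first.
  by case: ifP => [/uJ[-> ->]|/negbT/uNJ ->]; rewrite ?eqxx.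
by split=> x xJ; have := u_low x; rewrite ?xJ ?(negbTE xJ); [case/andP=> -> /eqP | move/eqP].
Qed.

Lemma raises_linkP u u' :
  reflect (lowered u /\ exists2 x, x \in J & u' = relink u x L) (raises_link u u').
Proof.
apply: (iffP andP) => [[u_low /exists_inP[x xJ /eqP ->]]|[u_low [x xJ ->]]].
  by split=> //; exists x.
by split=> //; apply/exists_inP; exists x.
Qed.

Lemma link_pairs : L \subset pairs Y.
Proof. by have /star_configP[_] := extremal_star_config g_ext. Qed.

Lemma lowered_neq u x : lowered u -> x \in J -> u x != L.
Proof.
move=> /loweredP[uJ _] /uJ[_ cardL]; apply: contraTneq isT => uxE.
by move: cardL; rewrite uxE; lia.
Qed.

Lemma star_config_lowered u : lowered u -> star_config X Y u.
Proof.
have /star_configP[gX gY] := extremal_star_config g_ext.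
move=> /loweredP[uJ uNJ]; apply/star_configP; split=> [|x].
  apply/subsetP => x; have [/(subsetP JX) //|xJ] := boolP (x \in J).
  by rewrite inE uNJ // => gx; rewrite (subsetP gX) // inE.
by have [/uJ[uL _]|/uNJ -> //] := boolP (x \in J); apply: subset_trans link_pairs.
Qed.

Lemma potential_lowered u : lowered u -> potential u < potential g.
Proof.
move=> /loweredP[uJ uNJ]; rewrite /potential (big_setID J) [X in _ < X](big_setID J) /=.
rewrite [X in _ + X < _](eq_big (mem (centers g :\: J)) (fun x => #|V|.+1 ^ #|g x|)); first last.
- by move=> x; rewrite !inE => /andP[xJ _]; rewrite uNJ.
- by move=> x; rewrite !inE; case: (boolP (x \in J)) => // /uNJ ->.
have L_gt0 : 0 < #|L| by move: v_center; rewrite card_gt0 inE.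
rewrite ltn_add2r [X in _ < X](big_setD1 v) /=; last by rewrite in_setI v_center.
apply: leq_trans (leq_addr _ _).
rewrite (eq_bigr (fun=> #|V|.+1 ^ #|L|.-1)) => [|x /setIP[_ /uJ[_ <-]]] //.
rewrite sum_nat_const -[in X in _ < X](prednK L_gt0) expnS ltn_pmul2r ?expn_gt0 //.
by rewrite ltnS max_card.
Qed.

Lemma lowered_not_embeds u : lowered u -> ~~ embeds F (b :|: stars u).
Proof.
move=> u_low; apply: (extremal_min g_ext); [exact: star_config_lowered| |exact: potential_lowered].
apply: leq_trans J_small; apply/subset_leq_card/subsetP => x; rewrite in_setU.
have [//|xJ] := boolP (x \in J); move/loweredP: u_low => [_ /(_ x xJ) uE].
by rewrite !inE uE.
Qed.

Lemma raised_embeds u x : lowered u -> x \in J -> embeds F (b :|: stars (relink u x L)).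
Proof.
move=> u_low xJ; have g_valid := extremal_star_config g_ext.
have : embeds F (b :|: stars (swap v x g)).
  by rewrite embeds_swap ?(subsetP JX) //; have /andP[/and3P[]] := g_ext.
apply: (embeds_mono F_uniform) => e _; apply/subsetP/setUS/stars_mono => y; rewrite !ffunE.
have [/loweredP[_ uNJ]] := u_low; case: tpermP => [->|->|/eqP yv /eqP/negbTE yx].
- have [->|xv] := eqVneq x v; first by [].
  by rewrite J_empty // sub0set.
- by rewrite eqxx.
by rewrite yx; have [yJ|/uNJ -> //] := boolP (y \in J); rewrite J_empty ?sub0set.
Qed.

Lemma raises_link_differ u u' e : raises_link u u' ->
    edge_query 3 (b :|: stars u) e != edge_query 3 (b :|: stars u') e ->
  exists x, [/\ x \in J, x \in e, e :\ x \in pairs Y, u' = relink u x L & u x = L :\ (e :\ x)].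
Proof.
move=> /raises_linkP[u_low [x xJ ->]] query_neq.
have [xe ex neq] := relink_query_neq (star_config_lowered u_low) link_pairs query_neq.
exists x; split=> //; have /loweredP[/(_ x xJ)[uL card_u] _] := u_low.
have [w wu LE] := subset_cardS uL (esym card_u).
move: neq; rewrite LE in_setU1; case: (e :\ x =P w) => [->|_]; last by rewrite eqxx.
by rewrite setU1K.
Qed.

Lemma raises_link_row u u' : raises_link u u' -> #|J| <= #|[set u' | raises_link u u']|.
Proof.
move=> /raises_linkP[u_low _].
rewrite -(card_in_imset (f := fun x => relink u x L)); last first.
  by move=> x y xJ _; apply/relink_inj/lowered_neq.
apply/subset_leq_card/subsetP => _ /imsetP[x xJ ->]; rewrite inE.
by apply/raises_linkP; split=> //; exists x.
Qed.

Lemma raises_link_column u u' : raises_link u u' -> #|L| <= #|[set u | raises_link u u']|.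
Proof.
move=> /raises_linkP[/loweredP[uJ uNJ] [x xJ ->]].
rewrite -(card_in_imset (f := fun w => relink u x (L :\ w))); last first.
  by move=> w w' wL w'L /ffunP/(_ x); rewrite !relink_same; apply: setD1_inj.
apply/subset_leq_card/subsetP => _ /imsetP[w wL ->]; rewrite inE.
apply/raises_linkP; split; last by exists x; rewrite ?relink_relink.
apply/loweredP; split=> y yJ; have [yx|yx] := eqVneq y x; rewrite ?yx ?relink_same ?relink_other //.
- by rewrite subsetDl [in RHS](cardsD1 w) wL.
- exact: uJ.
- by rewrite yx xJ in yJ.
exact: uNJ.
Qed.

Lemma link_lowering_bound : #|J| * #|L| <= q.
Proof.
have := @F_bounded _ _ raises_link (fun u => b :|: stars u) (fun u => b :|: stars u) #|J| #|L| 1 1.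
rewrite !mul1n; apply.
- have /set0Pn[w wL] : L != set0 by move: v_center; rewrite inE.
  pose u : config := [ffun x => if x \in J then L :\ w else g x].
  exists u, (relink u v L); apply/raises_linkP; split; last by exists v.
  apply/loweredP; split=> x xJ; rewrite ffunE ?xJ ?(negbTE xJ) //.
  by rewrite subsetDl [in RHS](cardsD1 w) wL.
- move=> u _ /raises_linkP[u_low [x xJ ->]]; split; first exact/negP/lowered_not_embeds.
  exact: raised_embeds.
- exact: raises_link_row.
- exact: raises_link_column.
- move=> e u _ _; apply/card_le1_eqP => u1 u2; rewrite !inE => /andP[rise1 neq1] /andP[rise2 neq2].
  have [x [xJ xe _ -> _]] := raises_link_differ rise1 neq1.
  have [y [_ _ ey -> _]] := raises_link_differ rise2 neq2.
  by rewrite (center_unique XY_disjoint ey xe (subsetP JX _ xJ)).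
move=> e _ u _; apply/card_le1_eqP => u1 u2; rewrite !inE => /andP[rise1 neq1] /andP[rise2 neq2].
have [x [xJ xe _ relinkE1 linkE1]] := raises_link_differ rise1 neq1.
have [y [_ _ ey relinkE2 linkE2]] := raises_link_differ rise2 neq2.
have xy := center_unique XY_disjoint ey xe (subsetP JX _ xJ); rewrite xy in relinkE1 linkE1.
rewrite -[u1](relink_id _ y) -[u2](relink_id _ y) linkE1 linkE2.
by rewrite -(relink_relink u1 y L) -relinkE1 relinkE2 relink_relink.
Qed.
End LinkLowering.

Lemma link_size_bound g v : h <= #|X| -> extremal g -> v \in centers g ->
  (h - #|centers g|).+1 * #|g v| <= q.
Proof.
move=> h_le g_ext v_center.
have gX : centers g \subset X by apply/subsetP => x; apply: extremal_center.
have [|J JX cardJ] := @subset_of_card _ (X :\: centers g) (h - #|centers g|).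
  by rewrite cardsD (setIidPr gX) leq_sub2r.
have J_empty x : x \in J -> g x = set0.
  by move/(subsetP JX); rewrite in_setD [x \in centers _]inE negbK => /andP[/eqP].
have vNJ : v \notin J by apply: contraTN v_center => /J_empty gv; rewrite inE gv eqxx.
have -> : (h - #|centers g|).+1 = #|v |: J| by rewrite cardsU1 vNJ cardJ.
apply: link_lowering_bound => //; first exact: setU11.
- by rewrite subUset sub1set (extremal_center g_ext v_center) (subset_trans JX) ?subsetDl.
- by move=> x; rewrite in_setU1 => /orP[/eqP ->|/J_empty //]; rewrite eqxx.
have g_few : #|centers g| <= h by have /andP[/and3P[]] := g_ext.
have -> : v |: J :|: centers g = J :|: centers g.
  by rewrite -setUA; apply/setUidPr; rewrite sub1set in_setU v_center orbT.
by apply: leq_trans (leq_card_setU _ _) _; rewrite cardJ subnK.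
Qed.

End ExtremalConfigurations.

Lemma card_transporter (V : finType) (G : {group {perm V}}) (e e' : {set V}) :
  #|[set s in G | s @: e == e']| * #|orbit 'P^* G e| <= #|G|.
Proof.
have [->|[s]] := set_0Vmem [set s in G | s @: e == e']; first by rewrite cards0.
rewrite inE => /andP[sG /eqP <-]; rewrite -[[set _ in G | _]]/(amove 'P^* G e ('P^*%act e s)).
by rewrite amove_act ?subsetT // card_rcoset mulnC card_orbit_stab.
Qed.

Section Packing.
Variables (V : finType) (r : nat) (F : {set {set V}}) (q : nat).
Hypothesis F_bounded : adversary_bounded (edge_query r) (embeds F) q.

Lemma card_separating_perms_le (G : {group {perm V}}) (b E : {set {set V}}) N k e :
    {in E, forall e', N <= k * #|orbit 'P^* G e'|} ->
  #|[set s in G | edge_query r b e != edge_query r (b :|: relabel s E) e]| * N <= k * #|E| * #|G|.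
Proof.
move=> orbit_ge; set separating := [set s in G | _].
have covered : separating \subset \bigcup_(e' in E) [set s in G | s @: e' == e].
  apply/subsetP => s; rewrite inE -{1}[b]setU0 => /andP[sG /edge_query_setU].
  rewrite in_set0 /relabel; case: imsetP => // -[e' e'E eE] _; apply/bigcupP; exists e' => //.
  by rewrite inE sG eE eqxx.
have := leq_trans (subset_leq_card covered) (card_bigcup_le _ _).
move=> /leq_mul/(_ (leqnn N))/leq_trans; apply.
rewrite big_distrl -mulnA mulnCA -sum_nat_const; apply: leq_sum => e' e'E /=.
apply: leq_trans (leq_mul (leqnn _) (orbit_ge e' e'E)) _.
by rewrite mulnCA leq_mul2l card_transporter orbT.
Qed.

Lemma orbit_packing_bound (G : {group {perm V}}) (b E : {set {set V}}) N k :
    {in G, forall s, relabel s b = b} -> {in E, forall e, N <= k * #|orbit 'P^* G e|} ->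
    ~~ embeds F b -> embeds F (b :|: E) ->
  N <= k * #|E| * q.
Proof.
move=> b_inv orbit_ge b_rej bE_acc; have [->//|N_gt0] := posnP N.
pose load := (k * #|E| * #|G|) %/ N.
have cardG_le : #|G| * 1 <= load * 1 * q.
  apply: (F_bounded (r := fun _ s => s \in G) (x := fun _ : unit => b)
    (y := fun s => b :|: relabel s E)).
  - by exists tt, 1%g; apply: group1.
  - move=> _ s sG; split; first exact/negP.
    by rewrite -{1}(b_inv s sG) -relabelU embeds_relabel.
  - by move=> _ _ _; apply/subset_leq_card/subsetP => s sG; rewrite inE.
  - by move=> _ s sG; apply/card_gt0P; exists tt; rewrite inE.
  - by move=> e _ _ _; rewrite leq_divRL //; apply: card_separating_perms_le.
  by move=> e _ s _; rewrite (leq_trans (max_card _)) // card_unit.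
rewrite -(leq_pmul2r (cardG_gt0 G)); rewrite !muln1 in cardG_le.
apply: leq_trans (leq_mul (leqnn N) cardG_le) _.
by rewrite mulnA [N * _]mulnC [X in _ <= X]mulnAC leq_mul2r leq_trunc_div orbT.
Qed.
End Packing.

Lemma pow5_le_of_pair m u k q : m <= 2 * u -> m <= 4 * k -> u * k <= q -> m ^ 5 <= (8 * q) ^ 3.
Proof.
move=> mu mk ukq; have m_sqr_le : m ^ 2 <= 8 * q by rewrite -mulnn; nia.
apply: (@leq_trans ((m ^ 2) ^ 3)); first by rewrite -expnM; case: (m) => // m'; rewrite leq_pexp2l.
by rewrite leq_exp2r.
Qed.

Lemma pow5_le_of_triple m u v k s q : m <= 2 * u -> m <= 4 * v -> 0 < k -> 0 < s ->
  u * k <= q -> v * s <= q -> m ^ 3 <= 54 * (k * s * q) -> m ^ 5 <= (8 * q) ^ 3.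
Proof.
move=> mu mv k_gt0 s_gt0 ukq vsq m_cube_le.
have mk_le : m * k <= 2 * q by nia.
have ms_le : m * s <= 4 * q by nia.
rewrite -(@leq_pmul2l (k * s)) ?muln_gt0 ?k_gt0 //.
apply: (@leq_trans (2 * q * (4 * q) * (54 * (k * s * q)))); last by rewrite !expnS expn0; nia.
have -> : k * s * m ^ 5 = m * k * (m * s) * m ^ 3 by rewrite !expnS expn0; lia.
by apply: leq_mul m_cube_le; apply: leq_mul.
Qed.

Section StarBound.
Variables (V : finType) (C : eqType) (F : {set {set V}}) (q : nat).
Hypotheses (F_uniform : uniform 3 F) (F_bounded : adversary_bounded (edge_query 3) (embeds F) q).
Variables (col : V -> C) (X Y : {set V}) (b : {set {set V}}) (m : nat).
Hypothesis col_X : {in X &, forall x y, col x = col y}.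
Hypothesis col_XY : {in X & Y, forall x y, col x != col y}.
Hypothesis b_inv : {in color_perms col, forall s, relabel s b = b}.
Hypothesis X_large : m <= #|X|.
Hypothesis Y_large : {in Y, forall y, m <= #|color_class col y|}.
Hypothesis b_rejected : ~~ embeds F b.
Local Notation config := {ffun V -> {set {set V}}}.

Lemma XY_disjoint : [disjoint X & Y].
Proof.
rewrite -setI_eq0; apply/set0Pn => -[x /setIP[xX xY]].
by have := col_XY xX xY; rewrite eqxx.
Qed.

Lemma star_packing_bound (g : config) d : star_config X Y g -> (forall x, #|g x| <= d) ->
  embeds F (b :|: stars g) -> m ^ 2 * m.-1 <= 27 * (#|centers g| * d) * q.
Proof.
move=> /star_configP[gX gY] g_le g_emb; apply: (@leq_trans (27 * #|stars g| * q)); last first.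
  by rewrite leq_mul2r leq_mul2l card_stars_le ?orbT.
apply: (orbit_packing_bound F_bounded b_inv _ b_rejected g_emb) => e /starsP[x xe ex].
have xX : x \in X by apply: (subsetP gX); rewrite inE; apply/set0Pn; exists (e :\ x).
have := subsetP (gY x) _ ex; rewrite inE => /andP[/subsetP exY /cards2P[a [c [ac exE]]]].
have [aY cY] : a \in Y /\ c \in Y by split; apply: exY; rewrite exE !inE eqxx ?orbT.
have -> : e = [set x; a; c] by rewrite -(setD1K xe) exE setUA.
apply: card_color_orbit; rewrite ?col_XY //; [| |exact: Y_large|exact: Y_large].
  rewrite /= !inE negb_or ac !andbT.
  by apply/andP; split; apply: contraTneq xX => ->; rewrite (disjointFl XY_disjoint).
apply: leq_trans X_large (leq_card_color_class _) => z zX.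
exact: col_X.
Qed.

Lemma extremal_bound g : 2 <= m -> extremal F b X Y #|X|./2 g -> m ^ 5 <= (8 * q) ^ 3.
Proof.
move=> m_ge2 g_ext; have /andP[/and3P[g_valid g_few g_emb] _] := g_ext.
have b_tperm : {in X &, forall x y, relabel (tperm x y) b = b}.
  by move=> x y xX yX; apply: b_inv; apply: tperm_color; apply: col_X.
have k_gt0 : 0 < #|centers g|.
  rewrite lt0n; apply: contraNneq b_rejected => k0.
  have : #|stars g| <= #|centers g| * #|{set V}| by apply: card_stars_le => x; apply: max_card.
  by rewrite k0 mul0n leqn0 cards_eq0 => /eqP stars0; rewrite stars0 setU0 in g_emb.
have [v v_center v_max] := @ex_largest_link _ g (etrans (esym (card_gt0 _)) k_gt0).
have link_gt0 : 0 < #|g v| by move: v_center; rewrite inE card_gt0.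
have move_bound := center_move_bound F_bounded XY_disjoint b_tperm g_ext.
have [k_small|k_large] := leqP (2 * #|centers g|) #|X|./2; last first.
  by apply: pow5_le_of_pair move_bound; lia.
have link_bound :=
  link_size_bound F_uniform F_bounded XY_disjoint b_tperm (half_le _) g_ext v_center.
have pack_bound := star_packing_bound g_valid v_max g_emb.
apply: pow5_le_of_triple k_gt0 link_gt0 move_bound link_bound _.
- by lia.
- by lia.
have -> : m ^ 3 = m ^ 2 * m by rewrite -expnSr.
nia.
Qed.

Theorem star_bound (X0 : {set V}) : 2 <= m -> X0 \subset X -> #|X0| <= #|X|./2 ->
  embeds F (b :|: stars (full_config X0 Y)) -> m ^ 5 <= (8 * q) ^ 3.
Proof.
move=> m_ge2 X0X X0_small full_emb.
have [|g g_ext] := @ex_extremal _ F b X Y #|X|./2 (full_config X0 Y); last first.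
  exact: extremal_bound g_ext.
have /star_configP[full_X0 full_Y] := star_config_full X0 Y.
rewrite /accepted full_emb (leq_trans (subset_leq_card full_X0)) // !andbT.
by apply/star_configP; split; first exact: subset_trans full_X0 X0X.
Qed.
End StarBound.

Lemma leq_expM a b c d k l : a ^ k <= b ^ l -> c ^ k <= d ^ l -> (a * c) ^ k <= (b * d) ^ l.
Proof. by rewrite !expnMn; apply: leq_mul. Qed.

Section SmallTransversalNumber.
Variables (V : finType) (F : {set {set V}}) (q : nat).
Hypotheses (F_uniform : uniform 3 F) (F_bounded : adversary_bounded (edge_query 3) (embeds F) q).
Local Notation n := #|V|.
Local Notation tau := (transversal_number F).
Implicit Types (A C P W X Y e : {set V}) (u v : V).

Definition two_in P : {set {set V}} := [set e : {set V} | 1 < #|e :&: P|].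

Definition joining v W : {set {set V}} := [set e : {set V} | (v \in e) && (e \in meeting W)].

Lemma relabel_two_in s P : relabel s (two_in P) = two_in (s @: P).
Proof.
apply: relabel_eq => e; rewrite !inE -imsetI ?card_perm_imset //.
by move=> x y _ _; apply: perm_inj.
Qed.

Let set0NF : set0 \notin F := uniform_set0 F_uniform isT.

Lemma embeds_two_in_star A P v : #|A|.+1 = tau -> [disjoint A & P] -> v \in P ->
  embeds F ((meeting A :|: two_in P) :|: stars (full_config [set v] (~: (A :|: P)))).
Proof.
move=> A_tau AP vP; have vA : v \notin A by rewrite (disjointFl AP vP).
have : embeds F (meeting (v |: A)) by rewrite embeds_meeting // cardsU1 vA -A_tau.
apply: (embeds_mono F_uniform) => e card_e /meetingP[x xe xvA]; rewrite !in_setU.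
have [//|eA] := boolP (e \in meeting A); have [//|eP /=] := boolP (e \in two_in P).
have notA y : y \in e -> y \notin A by move=> ye; apply: contra eA => yA; apply/meetingP; exists y.
have ve : v \in e by move: xvA; rewrite in_setU1 (negbTE (notA x xe)) orbF => /eqP <-.
apply/starsP; exists v => //; rewrite ffunE set11 inE; rewrite card_setD1 // card_e andbT.
apply/subsetP => y /setD1P[yv ye]; rewrite !inE negb_or notA //=.
by apply: contra eP => yP; rewrite inE (cardsD1 v) (cardsD1 y) !inE ve vP ye yP yv.
Qed.

Lemma ex_residual_vertex A P C u e : u \notin A -> (forall x, x \in e -> x \in C -> x = u) ->
  e \in meeting A :|: two_in P -> exists2 x, x \in e & x \in (A :|: P) :\: C.
Proof.
move=> uA only_u; have notC x : x \in e -> x != u -> x \notin C.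
  by move=> xe; apply: contraNN => /(only_u x xe) ->.
rewrite in_setU => /orP[/meetingP[x xe xA]|].
  exists x; rewrite // !inE xA notC //.
  by apply: contraNneq uA => <-.
rewrite inE => /(ex_other u)[x /setIP[xe xP] xu]; exists x => //.
by rewrite !inE xP orbT notC.
Qed.

(* A transversal [C] is moved onto [v |: A], and the part of [A] and [P] outside [C] into [W]. *)
Lemma embeds_joining A P W v : #|A|.+1 = tau -> embeds F (meeting A :|: two_in P) ->
    v \notin A -> v \notin W -> [disjoint A & W] -> #|A| + #|P| <= #|W| ->
  embeds F (meeting A :|: joining v W).
Proof.
move=> A_tau /embedsP[s sF] vA vW AW W_large; have [C FC C_tau] := minimum_transversal set0NF.
pose A' := s^-1%g @: A; pose P' := s^-1%g @: P.
have [u uC uA'] : exists2 u, u \in C & u \notin A'.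
  by apply/subsetPn; apply: contraTN isT => /subset_leq_card; rewrite card_perm_imset; lia.
pose D := (A' :|: P') :\: C.
have [W' W'W W'D] : exists2 W' : {set V}, W' \subset W & #|W'| = #|D|.
  apply: subset_of_card; apply: leq_trans W_large.
  apply: leq_trans (subset_leq_card (subsetDl _ _)) _.
  by apply: leq_trans (leq_card_setU _ _) _; rewrite !card_perm_imset.
have [|||p [pC pu pD]] := @perm_of_disjoint_sets _ [:: C :\ u; [set u]; D] [:: A; [set v]; W'].
- rewrite /= !andbT disjoint_sym disjoints1 disjoints1 !inE eqxx uC /= andbT.
  by rewrite -setI_eq0; apply/eqP/setP => x; rewrite !inE; case: (x \in C); rewrite ?andbF.
- rewrite /= !andbT disjoint_sym disjoints1 disjoints1 vA (disjointWr W'W AW) /=.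
  by apply: contra vW; apply: (subsetP W'W).
- by rewrite /= !cards1 W'D; have := cardsD1 u C; rewrite uC C_tau -A_tau add1n => -[->].
apply/embedsP; exists p => e eF; rewrite in_setU.
have [//|eA /=] := boolP (p @: e \in meeting A).
have only_u x : x \in e -> x \in C -> x = u.
  move=> xe xC; apply/eqP; apply: contraNT eA => xu; apply/meetingP.
  by exists (p x); [exact: imset_f | rewrite -pC imset_f // !inE xu].
have ue : u \in e by have /meetingP[x xe xC] := subsetP FC _ eF; rewrite -(only_u x).
have [x xe xD] : exists2 x, x \in e & x \in D.
  apply: (ex_residual_vertex uA' only_u); rewrite -(mem_relabel s) relabelU.
  by rewrite relabel_meeting relabel_two_in !perm_imsetKV sF.
rewrite inE; apply/andP; split; first by rewrite imset_set1 in pu; rewrite -(set1_inj pu) imset_f.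
by apply/meetingP; exists (p x); rewrite ?imset_f // (subsetP W'W) // -pD imset_f.
Qed.

Lemma joining_sub_stars A X0 X Y W u e : #|e| = 3 -> u \in X0 -> u \in X -> W \subset Y ->
    [disjoint X & Y] -> ~: A \subset X :|: Y -> e \in meeting A :|: joining u W ->
  e \in meeting A :|: stars (full_config X0 Y) :|: stars (full_config W X).
Proof.
move=> card_e uX0 uX WY XY AXY; rewrite !in_setU.
have [//|eA /=] := boolP (e \in meeting A); rewrite inE => /andP[ue /meetingP[w we wW]].
have wY := subsetP WY _ wW; have uw : u != w by apply: contraTneq uX => ->; rewrite (disjointFl XY).
have [eY|/subsetPn[z /setD1P[zu ze] zY]] := boolP (e :\ u \subset Y).
  apply/orP; left; apply/starsP; exists u; rewrite // ffunE uX0 inE eY /=.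
  by rewrite card_setD1 // card_e.
have zw : z != w by apply: contraNneq zY => ->.
have zX : z \in X.
  have : z \in ~: A by rewrite inE; apply: contra eA => zA; apply/meetingP; exists z.
  by move/(subsetP AXY); rewrite in_setU (negbTE zY) orbF.
apply/orP; right; apply/starsP; exists w; rewrite // ffunE wW inE.
have uz : u != z by rewrite eq_sym.
have -> : e :\ w = [set u; z].
  apply/esym/eqP; rewrite eqEcard cards2 uz card_setD1 // card_e andbT.
  by rewrite subUset !sub1set !in_setD1 uw ue zw.
by rewrite subUset !sub1set uX zX cards2 uz.
Qed.

Lemma two_in_bound A P m : #|A|.+1 = tau -> [disjoint A & P] -> 2 <= m ->
    m <= #|P| -> m <= #|~: (A :|: P)| -> ~~ embeds F (meeting A :|: two_in P) ->
  m ^ 5 <= (8 * q) ^ 3.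
Proof.
move=> A_tau AP m_ge2 mP mY b_rej; have /card_gt0P[v vP] : 0 < #|P| by apply: leq_trans mP; lia.
pose col x := (x \in A, x \in P).
have colP x : x \in P -> col x = (false, true) by move=> xP; rewrite /col xP (disjointFl AP).
have colY y : y \in ~: (A :|: P) -> col y = (false, false).
  by rewrite !inE negb_or /col => /andP[/negbTE -> /negbTE ->].
apply: (@star_bound _ _ F q F_uniform F_bounded col P (~: (A :|: P)) _ m _ _ _ mP _ b_rej
  [set v]) => //.
- by move=> x y /colP -> /colP ->.
- by move=> x y /colP -> /colY ->.
- move=> s s_col; rewrite relabelU relabel_meeting relabel_two_in.
  by rewrite !(color_perm_imset _ s_col) // => x y [].
- move=> y yY; apply: leq_trans mY (leq_card_color_class _) => z zY.
  by rewrite !colY.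
- by rewrite sub1set.
- by rewrite cards1 half_gt0; apply: leq_trans mP.
exact: embeds_two_in_star.
Qed.

Lemma one_sided_bound A X Y X0 m : #|A|.+1 = tau -> [disjoint A & Y] -> X = ~: (A :|: Y) ->
    2 <= m -> m <= #|X| -> m <= #|Y| -> X0 \subset X -> #|X0| <= #|X|./2 ->
    embeds F (meeting A :|: stars (full_config X0 Y)) ->
  m ^ 5 <= (8 * q) ^ 3.
Proof.
move=> A_tau AY XE m_ge2 mX mY X0X X0_small emb; pose col x := (x \in A, x \in Y).
have colY y : y \in Y -> col y = (false, true) by move=> yY; rewrite /col yY (disjointFl AY).
have colX x : x \in X -> col x = (false, false).
  by rewrite XE !inE negb_or /col => /andP[/negbTE -> /negbTE ->].
apply: (@star_bound _ _ F q F_uniform F_bounded col X Y (meeting A) m _ _ _ mX _ _ X0) => //.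
- by move=> x y /colX -> /colX ->.
- by move=> x y /colX -> /colY ->.
- move=> s s_col; rewrite relabel_meeting.
  by rewrite (color_perm_imset _ s_col) // => x y [].
- move=> y yY; apply: leq_trans mY (leq_card_color_class _) => z zY.
  by rewrite !colY.
by rewrite embeds_meeting // -ltnNge -A_tau.
Qed.

Lemma two_sided_bound A X Y X0 W m : [disjoint A & Y] -> X = ~: (A :|: Y) -> 2 <= m ->
    m <= #|Y| -> m <= #|X0| -> m <= #|X :\: X0| -> X0 \subset X -> W \subset Y -> #|W| <= #|Y|./2 ->
    ~~ embeds F (meeting A :|: stars (full_config X0 Y)) ->
    embeds F (meeting A :|: stars (full_config X0 Y) :|: stars (full_config W X)) ->
  m ^ 5 <= (8 * q) ^ 3.
Proof.
move=> AY XE m_ge2 mY mX0 mX1 X0X WY W_small b_rej emb; pose col x := (x \in A, x \in Y, x \in X0).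
have colX x : x \in X -> col x = (false, false, x \in X0).
  by rewrite XE !inE negb_or /col => /andP[/negbTE -> /negbTE ->].
have colY y : y \in Y -> col y = (false, true, false).
  move=> yY; rewrite /col yY (disjointFl AY yY); congr (_, _, _).
  apply: contraTF yY => /(subsetP X0X).
  by rewrite XE !inE negb_or => /andP[].
apply: (@star_bound _ _ F q F_uniform F_bounded col Y X _ m _ _ _ mY _ b_rej W) => //.
- by move=> x y /colY -> /colY ->.
- by move=> x y /colY -> /colX ->.
- move=> s s_col; rewrite relabelU relabel_meeting relabel_stars relabel_full_config.
  by rewrite !(color_perm_imset _ s_col) // => x y [].
move=> y yX; have [yX0|yX0] := boolP (y \in X0).
  apply: leq_trans mX0 (leq_card_color_class _) => z zX0.
  by rewrite !colX ?(subsetP X0X) // zX0 yX0.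
apply: leq_trans mX1 (leq_card_color_class _) => z /setDP[zX zX0].
by rewrite !colX // (negbTE zX0) (negbTE yX0).
Qed.

Lemma ex_disjoint_subset A k : k <= n - #|A| -> exists2 B : {set V}, #|B| = k & [disjoint A & B].
Proof.
have -> : n - #|A| = #|~: A| by have := cardsC A; lia.
move=> /subset_of_card[B BA cardB]; exists B => //.
by rewrite disjoint_sym disjoints_subset.
Qed.

Lemma part_sizes N a (d := N %/ 8) (x := N - (a + N./2)) : 100 * a.+1 < N ->
  [/\ 2 <= d, a + d + d <= N, a + N./2 <= N, a + d <= N./2./2 & d <= x./2 /\ d <= x - x./2].
Proof. by rewrite /x /d => N_large; do !split; lia. Qed.

Lemma card_setCU A (B : {set V}) : [disjoint A & B] -> #|~: (A :|: B)| = n - (#|A| + #|B|).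
Proof.
by move=> AB; rewrite -(cardsC (A :|: B)) cardsU (disjoint_setI0 AB) cards0 subn0 addKn.
Qed.

Lemma accepted_two_in_bound A P (d := n %/ 8) :
    #|A|.+1 = tau -> 100 * tau < n -> #|P| = d -> embeds F (meeting A :|: two_in P) ->
  d ^ 5 <= (8 * q) ^ 3.
Proof.
move=> A_tau; rewrite -A_tau => /part_sizes[d_ge2 _ AY_le W_le [X0_le X1_le]] cardP two_in_acc.
have [|Y cardY AY] := @ex_disjoint_subset A n./2; first by rewrite leq_subRL ?max_card.
pose X := ~: (A :|: Y); have cardX : #|X| = n - (#|A| + n./2) by rewrite card_setCU ?cardY.
have [|W WY cardW] := @subset_of_card _ Y (#|A| + d).
  by rewrite cardY (leq_trans W_le) ?half_le.
have [|X0 X0X cardX0] := @subset_of_card _ X #|X|./2; first exact: half_le.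
have X0_large : d <= #|X0| by rewrite cardX0 cardX.
have Y_large : d <= #|Y|.
  by rewrite cardY; apply: leq_trans (half_le _); apply: leq_trans W_le; apply: leq_addl.
have /card_gt0P[u uX0] : 0 < #|X0| by apply: leq_trans X0_large; apply: ltnW.
have /andP[uA uY] : (u \notin A) && (u \notin Y).
  by have := subsetP X0X _ uX0; rewrite inE in_setU negb_or.
have joining_acc : embeds F (meeting A :|: joining u W).
  apply: (embeds_joining A_tau two_in_acc uA); last by rewrite cardP cardW.
    by apply: contra uY; apply: (subsetP WY).
  exact: disjointWr WY AY.
have [one_sided_acc|one_sided_rej] := boolP (embeds F (meeting A :|: stars (full_config X0 Y))).
  apply: (one_sided_bound A_tau AY erefl d_ge2 _ Y_large X0X _ one_sided_acc).
    exact: leq_trans X0_large (subset_leq_card X0X).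
  by rewrite cardX0.
apply: (two_sided_bound AY erefl d_ge2 Y_large X0_large _ X0X WY _ one_sided_rej).
- by rewrite cardsD (setIidPr X0X) cardX0 cardX.
- by rewrite cardW cardY.
apply: (embeds_mono F_uniform) joining_acc => e card_e.
apply: (joining_sub_stars card_e uX0 (subsetP X0X _ uX0) WY).
  by rewrite disjoint_sym disjoints_subset setCK subsetUr.
by rewrite /X setCU; apply/subsetP => x; rewrite !inE => ->; case: (x \in Y).
Qed.

Lemma small_transversal_number_bound : F != set0 -> 100 * tau < n -> (n %/ 8) ^ 5 <= (8 * q) ^ 3.
Proof.
move=> F_neq0 tau_small; have tau_gt0 := transversal_number_gt0 set0NF F_neq0.
have [|A _ cardA] := @subset_of_card V setT tau.-1.
  have [C _ <-] := minimum_transversal set0NF.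
  by rewrite cardsT (leq_trans (leq_pred _)) ?max_card.
have A_tau : #|A|.+1 = tau by rewrite cardA prednK.
have [|d_ge2 AP_le _ _ _] := @part_sizes n #|A|; first by rewrite A_tau.
have AP_le' := leq_trans (leq_addr _ _) AP_le.
have [|P cardP AP] := @ex_disjoint_subset A (n %/ 8); first by rewrite leq_subRL ?max_card.
have [|two_in_rej] := boolP (embeds F (meeting A :|: two_in P)).
  exact: accepted_two_in_bound A_tau tau_small cardP.
by apply: two_in_bound two_in_rej; rewrite ?card_setCU ?cardP // leq_subRL.
Qed.

Theorem card_pow5_bound : 3 <= n -> F != set0 -> n ^ 5 <= (1800 * q) ^ 3.
Proof.
move=> n_ge3 F_neq0; have [n_le|tau_small] := leqP n (100 * tau).
  by apply: (large_transversal_number_bound F_uniform F_bounded) => //; rewrite card_gt0.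
have tau_gt0 := transversal_number_gt0 set0NF F_neq0.
apply: (@leq_trans ((2 ^ 4 * (n %/ 8)) ^ 5)); first by rewrite leq_exp2r //; lia.
have pow_le : (2 ^ 4) ^ 5 <= (2 ^ 7) ^ 3 by rewrite -!expnM leq_exp2l.
apply: leq_trans (leq_expM pow_le (small_transversal_number_bound F_neq0 tau_small)) _.
rewrite leq_exp2r; last by [].
by rewrite mulnA; apply: leq_mul (leqnn q).
Qed.
End SmallTransversalNumber.

(** * Query complexity of subhypergraph containment *)

Lemma cards3 (T : finType) (x y z : T) : x != y -> y != z -> x != z -> #|[set x; y; z]| = 3.
Proof.
by move=> xy yz xz; rewrite setUC cardsU1 cards2 !inE xy negb_or ![z == _]eq_sym xz yz.
Qed.

Lemma sort3E x y z : [:: min3 x y z; mid3 x y z; max3 x y z] = sort leq [:: x; y; z].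
Proof.
rewrite /mid3 /min3 /max3 /sort /=.
by do 3?[case: ifP => ? /=]; congr [:: _; _; _]; lia.
Qed.

Section Encoding.
Variable n' : nat.
Local Notation n := n'.+1.
Local Notation triple a b c := [set inord a; inord b; inord c : 'I_n].

Definition graph_of (E : {set {set 'I_n}}) : hgraph := fun a b c => triple a b c \in E.

Definition edges (H : hgraph) : {set {set 'I_n}} :=
  [set e | [exists a : 'I_n, exists b : 'I_n, exists c : 'I_n,
     [&& a < b, b < c, H a b c & e == [set a; b; c]]]].

Lemma edgesP (H : hgraph) (e : {set 'I_n}) :
  reflect (exists a b c : 'I_n, [/\ a < b, b < c, H a b c & e = [set a; b; c]]) (e \in edges H).
Proof.
rewrite inE; apply: (iffP existsP) => [[a /existsP[b /existsP[c /and4P[ab bc h /eqP ->]]]]|].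
  by exists a, b, c.
case=> a [b [c [ab bc h ->]]]; exists a; apply/existsP; exists b; apply/existsP; exists c.
by rewrite ab bc h eqxx.
Qed.

Lemma card_triple a b c : a < b -> b < c -> c < n -> #|triple a b c| = 3.
Proof. by move=> ab bc cn; rewrite cards3 // -val_eqE /= !inordK; lia. Qed.

Lemma edges_uniform (H : hgraph) : uniform 3 (edges H).
Proof.
move=> _ /edgesP[a [b [c [ab bc _ ->]]]].
by rewrite -[a]inord_val -[b]inord_val -[c]inord_val card_triple.
Qed.

Lemma mem_edges (H : hgraph) a b c :
  a < b -> b < c -> c < n -> H a b c -> triple a b c \in edges H.
Proof.
move=> ab bc cn h; apply/edgesP; exists (inord a), (inord b), (inord c).
by rewrite !inordK //; lia.
Qed.

Lemma hasE_graph_of E x y z : hasE (graph_of E) x y z = (triple x y z \in E).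
Proof.
rewrite /hasE /graph_of; congr (_ \in E).
have set3E a b c : triple a b c = [set v in map inord [:: a; b; c]].
  by apply/setP => v; rewrite !inE orbA.
rewrite !set3E sort3E; apply/setP => v; rewrite [LHS]inE [RHS]inE.
by apply/perm_mem/perm_map; rewrite perm_sort.
Qed.

Lemma contains_embeds (H : hgraph) E : contains n H (graph_of E) <-> embeds (edges H) E.
Proof.
split=> [[f [f_lt [f_inj fP]]]|/embedsP[s sP]].
  have f'_inj : injective (fun i : 'I_n => inord (f i) : 'I_n).
    move=> i j /(congr1 val); rewrite /= !inordK; try exact/ssrnat.ltP/f_lt/ssrnat.ltP.
    by move=> /(f_inj _ _ (ssrnat.ltP (ltn_ord i)) (ssrnat.ltP (ltn_ord j))); apply: val_inj.
  apply/embedsP; exists (perm f'_inj) => _ /edgesP[a [b [c [ab bc h ->]]]].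
  have := fP a b c (ssrnat.ltP ab) (ssrnat.ltP bc) (ssrnat.ltP (ltn_ord c)) h.
  by rewrite hasE_graph_of !imsetU !imset_set1 !permE.
exists (fun i => s (inord i) : nat); split; [|split].
- by move=> i _; apply/ssrnat.ltP.
- move=> i j /ssrnat.ltP iN /ssrnat.ltP jN /val_inj /perm_inj /(congr1 val).
  by rewrite /= !inordK.
move=> a b c /ssrnat.ltP ab /ssrnat.ltP bc /ssrnat.ltP cn h.
by have /sP := mem_edges ab bc cn h; rewrite hasE_graph_of !inord_val !imsetU !imset_set1.
Qed.

End Encoding.

Lemma qstateE n m U G t : qstate n m U G t = phase_run (qdim n m) U (phase n m G) t.
Proof. by elim: t => //= t ->. Qed.

Section PhaseQueries.
Import Order.TTheory GRing.Theory Num.Theory.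
Local Open Scope ring_scope.

Lemma phase_sqr n m G k : phase n m G k ^+ 2 = 1.
Proof. by rewrite /phase; case: ifP => _; [case: (G _ _ _)|]; rewrite expr2 -RmultE -mult_IZR. Qed.

Lemma phase_neq n m k : (0 < n)%N -> exists a b c, forall G G',
  phase n m G k != phase n m G' k -> [/\ (a < b)%N, (b < c)%N, (c < n)%N & G a b c != G' a b c].
Proof.
move=> n_gt0; do 3 eexists; move=> G G'; rewrite /phase.
case: ifP => [/andP[/PeanoNat.Nat.ltb_lt/ssrnat.ltP ab /PeanoNat.Nat.ltb_lt/ssrnat.ltP bc]|_].
  move=> phase_GG'; split; [exact: ab | exact: bc | | by apply: contra_neq phase_GG' => ->].
  by apply/ssrnat.ltP/PeanoNat.Nat.mod_upper_bound; lia.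
by rewrite eqxx.
Qed.

Lemma prob1E n m U out G T : prob1 n m U out G T =
  \sum_(k < qdim n m | out k) Cnorm2 (phase_run (qdim n m) U (phase n m G) T k).
Proof.
rewrite /prob1 /Rsum fold_right_seqE [RHS]big_mkcond; apply: eq_bigr => k _.
by rewrite qstateE.
Qed.

End PhaseQueries.

Theorem computes_adversary_bounded n' (H : hgraph) m T U out :
    computes_fH n'.+1 H m T U out ->
  adversary_bounded (edge_query 3) (embeds (edges n' H)) (1296 * T ^ 2).
Proof.
move=> [/ssrnat.ltP m_gt0 [U_unitary correct]]; set n := n'.+1.
apply: (adversary_bounded_transfer (query := fun G (k : 'I_(qdim n m)) => phase n m G k)
  (accepts := contains n H) (code := @graph_of n')) => [E|k|].
- exact: contains_embeds.
- have [a [b [c abcP]]] := @phase_neq n m k isT.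
  exists [set inord a; inord b; inord c] => E E' /abcP[ab bc cn].
  by rewrite /edge_query (card_triple ab bc cn).
apply: (@ambainis_bound _ U T out) => [||G k|G GH|G GH].
- by rewrite /qdim !multE !muln_gt0.
- by move=> t /ssrnat.leP; apply: U_unitary.
- exact: phase_sqr.
- by have [+ _] := correct G => /(_ GH)/Rge_le/RleP; rewrite prob1E !RealsE.
by have [_ +] := correct G => /(_ GH)/RleP; rewrite prob1E !RealsE.
Qed.

Theorem query_bound n (H : hgraph) m T U out : 3 <= n ->
    (exists a b c, [/\ a < b, b < c, c < n & H a b c]) -> computes_fH n H m T U out ->
  n ^ 5 <= (1800 * T) ^ 6.
Proof.
case: n => // n' n_ge3 [a [b [c [ab bc cn Habc]]]] /computes_adversary_bounded bounded.
have edges_neq0 : edges n' H != set0.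
  by apply/set0Pn; exists [set inord a; inord b; inord c]; apply: mem_edges.
have := card_pow5_bound (@edges_uniform n' H) bounded.
rewrite card_ord => /(_ n_ge3 edges_neq0)/leq_trans-> //.
rewrite (expnM _ 2 3) leq_exp2r; last by [].
have const_le : 1296 <= 1800 by [].
rewrite expnMn -[1800 ^ 2]mulnn -mulnA.
exact: leq_mul (leqnn _) (leq_mul const_le (leqnn _)).
Qed.

Local Open Scope R_scope.

Lemma Rpower_le_root (x y a : R) k l : 1 <= x -> 0 <= y -> x ^ k <= y ^ l.+1 ->
  a * INR l.+1 <= INR k -> Rpower x a <= y.
Proof.
move=> x_ge1 y_ge0 xy al_le; have x_gt0 : 0 < x by apply: Rlt_le_trans x_ge1; apply: Rlt_0_1.
have pow_le : Rpower x a ^ l.+1 <= y ^ l.+1.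
  apply: Rle_trans xy; rewrite -(Rpower_pow _ (Rpower x a)); last exact: exp_pos.
  by rewrite -(Rpower_pow _ x) // Rpower_mult; apply: Rle_Rpower.
have xa_ge0 : 0 <= Rpower x a by apply/Rlt_le/exp_pos.
move: pow_le xa_ge0 y_ge0 => /RleP + /RleP + /RleP; rewrite !RpowE => pow_le xa_ge0 y_ge0.
by apply/RleP; rewrite -(@Num.Theory.ler_pXn2r _ l.+1).
Qed.

Lemma INR_query_bound n (H : hgraph) m T U out : Peano.le 3 n ->
    (exists a b c, Peano.lt a b /\ Peano.lt b c /\ Peano.lt c n /\ H a b c = true) ->
    computes_fH n H m T U out ->
  INR n ^ 5 <= (1800 * INR T) ^ 6.
Proof.
move=> /leP n_ge3 [a [b [c [/ltP ab [/ltP bc [/ltP cn Habc]]]]]] alg.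
have bound : (n ^ 5 <= (1800 * T) ^ 6)%N by apply: query_bound alg => //; exists a, b, c.
by apply/RleP; rewrite !RealsE -GRing.natrM -!GRing.natrX Num.Theory.ler_nat.
Qed.
End HypergraphQueries.

Theorem theorem4 :
  exists c : R, c > 0 /\
    forall (n : nat), (3 <= n)%nat ->
    forall H : hgraph,
      (exists a b d, (a < b)%nat /\ (b < d)%nat /\ (d < n)%nat /\ H a b d = true) ->
      forall (m T : nat) (U : nat -> nat -> nat -> Cx) (out : nat -> bool),
        computes_fH n H m T U out ->
        INR T >= c * Rpower (INR n) (4 / 5).
Proof.
exists (1 / 1800); split; [lra|].
intros n n_ge3 H H_edge m T U out alg.
assert (bound := HypergraphQueries.INR_query_bound n_ge3 H_edge alg).
assert (n_ge1 : 1 <= INR n) by (apply (le_INR 1); lia).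
assert (T_ge0 := pos_INR T).
assert (root_bound : Rpower (INR n) (4 / 5) <= 1800 * INR T).
{ apply HypergraphQueries.Rpower_le_root with (k := 5%nat) (l := 5%nat);
    [exact n_ge1|lra|exact bound|simpl; lra]. }
lra.
Qed.
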